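(* Let $k\ge1$ be an integer and let $u\in V_k\Lambda^0(\mathfrak N^4)$ be a polynomial 0-form for which all the degrees of freedom $\Sigma^{k,0}(\mathfrak N^4)$ vanish. Then $u\equiv0$.
   Context: The reference tetrahedral prism is $\mathfrak N^4=\mathfrak T^3\times\mathfrak T^1$, where $\mathfrak T^3=\{(x_1,x_2,x_3): -1\le x_i\le1,\ x_1+x_2+x_3\le-1\}$ is a tetrahedron with vertices $(1,-1,-1),(-1,1,-1),(-1,-1,1),(-1,-1,-1)$ and barycentric coordinates $\lambda_1,\dots,\lambda_4$ (in that order), and $\mathfrak T^1=[-1,1]$ (variable $x_4$) with barycentric coordinates $\nu_1,\nu_2$. It has 8 vertices, 16 edges, 8 triangular faces, 6 quadrilateral faces (edge of $\mathfrak T^3$ times $\mathfrak T^1$), 2 tetrahedral facets ($x_4=\pm1$) and 4 triangular-prism facets (triangular face of $\mathfrak T^3$ times $\mathfrak T^1$). $P^j(\cdot)$ are polynomials of total degree $\le j$ on the indicated set ($\{0\}$ if $j<0$); $A\times B$ of polynomial spaces means the span of products $ab$, $a\in A,b\in B$; $Q^{a,b}$ on a quadrilateral face is the space of polynomials of degree $\le a$ along the edge of $\mathfrak T^3$ and $\le b$ in $x_4$. $V_k\Lambda^0(\mathfrak N^4)=P^k(\mathfrak T^1)\times P^k(\mathfrak T^3)$. Put $\vartheta^b(x_1,x_2,x_3)=\lambda_1\lambda_2\lambda_3\lambda_4$ and $\vartheta^b(x_4)=\nu_1\nu_2$. Degrees of freedom $\Sigma^{k,0}(\mathfrak N^4)$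 of $u$: - values at the 8 vertices; - $\int_eu\,q$, $q\in P^{k-2}(e)$, each edge $e$; - $\int_fu\,q$, $q\in P^{k-3}(f)$, each triangular face $f$; - $\int_fu\,q$, $q\in Q^{k-2,k-2}(f)$, each quadrilateral face $f$; - $\int_{\mathcal F}u\,q$, $q\in P^{k-4}(\mathcal F)$, each tetrahedral facet $\mathcal F$; - $\int_{\mathcal F}u\,q$, $q\in P^{k-2}(\mathfrak T^1)\times P^{k-3}(T)$, each triangular-prism facet $\mathcal F=T\times\mathfrak T^1$; - $\int_{\mathfrak N^4}u\,q\,\vartheta^b(x_1,x_2,x_3)\,\vartheta^b(x_4)$, $q\in P^{k-2}(\mathfrak T^1)\times P^{k-4}(\mathfrak T^3)$. *)

(* Defs.v *)
From HB Require Import structures.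
From mathcomp Require Import all_boot all_order all_algebra.
From mathcomp Require Import all_classical all_reals all_analysis.
(* The notations of mpoly clash with those of MathComp-Analysis:
   [mpoly 4 R] is the type of polynomials in 4 variables over R, and
   [meval v p] is the value of p at v. *)
From mathcomp Require mpoly.
Export -(notations) mpoly.

Set Implicit Arguments.
Unset Strict Implicit.
Unset Printing Implicit Defensive.

Import Order.TTheory GRing.Theory Num.Theory.
Import numFieldNormedType.Exports.

Local Open Scope classical_set_scope.
Local Open Scope ring_scope.

Section Prism.
Variable R : realType.

(* Points of R^4 are row vectors; the coordinates x_1, x_2, x_3, x_4 have the
   indices 0, 1, 2, 3 : 'I_4, and x_4 = x 0 ord_max. *)
Definition pt (d : nat) (s : seq R) : 'rV[R]_d := \row_(i < d) s`_i.

Definition ev (p : mpoly 4 R) (x : 'rV[R]_4) : R := meval (x 0) p.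

Definition N4 : set 'rV[R]_4 :=
  [set x | [/\ forall i : 'I_4, (i < 3)%N -> -1 <= x 0 i <= 1,
               \sum_(i < 4 | (i < 3)%N) x 0 i <= -1
             & -1 <= x 0 ord_max <= 1]].

(* [vtx i b] is the i-th vertex of the tetrahedron, in the order (1,-1,-1),
   (-1,1,-1), (-1,-1,1), (-1,-1,-1), at the height x_4 = 1 if b, and -1 if
   not. For i = 3 no coordinate x_1, x_2, x_3 equals 1. *)
Definition vtx (i : 'I_4) (b : bool) : 'rV[R]_4 :=
  \row_(j < 4) if j == ord_max then (if b then 1 else -1)
               else if j == i then 1 else -1.

Definition lambda (i : 'I_4) (x : 'rV[R]_4) : R :=
  if i == ord_max then - (1 + \sum_(j < 4 | (j < 3)%N) x 0 j) / 2
  else (1 + x 0 i) / 2.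

Definition nu (b : bool) (x : 'rV[R]_4) : R :=
  if b then (1 + x 0 ord_max) / 2 else (1 - x 0 ord_max) / 2.

Definition theta_T3 (x : 'rV[R]_4) : R := \prod_(i < 4) lambda i x.
Definition theta_T1 (x : 'rV[R]_4) : R := nu false x * nu true x.

(* The polynomials on a subset of R^4 are the restrictions of polynomials in
   the four ambient variables. Degree bounds are integers, so that a negative
   one leaves the zero polynomial only. *)
Definition PolyP (j : int) (p : mpoly 4 R) : Prop :=
  forall m, m \in msupp p -> (mdeg m)%:Z <= j.

(* P^j(T^3) and P^j(T^1): the polynomials in x_1, x_2, x_3, resp. in x_4. *)
Definition PolyT3 (j : int) (p : mpoly 4 R) : Prop :=
  PolyP j p /\ (forall m, m \in msupp p -> m ord_max = 0%N).

Definition PolyT1 (j : int) (p : mpoly 4 R) : Prop :=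
  PolyP j p /\
  (forall m, m \in msupp p -> forall i : 'I_4, i != ord_max -> m i = 0%N).

(* P^a(T^1) x P^b(T^3): the span of the products. *)
Definition PolyProd (a b : int) (p : mpoly 4 R) : Prop :=
  exists (n : nat) (f g : 'I_n -> mpoly 4 R),
    [/\ forall i, PolyT1 a (f i), forall i, PolyT3 b (g i)
      & p = \sum_(i < n) f i * g i].

(* Q^{a,b}, to be restricted to a quadrilateral face e x T^1: degree <= a in
   (x_1, x_2, x_3), hence along e, and degree <= b in x_4. *)
Definition PolyQ (a b : int) (p : mpoly 4 R) : Prop :=
  forall m, m \in msupp p ->
    (\sum_(i < 4 | (i < 3)%N) m i)%N%:Z <= a /\ (m ord_max)%:Z <= b.

Definition VL0 (k : nat) (u : mpoly 4 R) : Prop := PolyProd k%:Z k%:Z u.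

Let mR := measurableTypeR R.
Definition leb1 : {sigma_finite_measure set mR -> \bar R} :=
  @lebesgue_measure R.
Definition leb2 : {measure set (mR * mR) -> \bar R} := (leb1 \x leb1)%E.
Definition leb3 : {measure set (mR * mR * mR) -> \bar R} := (leb2 \x leb1)%E.
Definition leb4 : {measure set (mR * mR * mR * mR) -> \bar R} :=
  (leb3 \x leb1)%E.

Definition unit_segment : set R := `[0, 1].
Definition unit_triangle : set (R * R) :=
  [set z | [/\ 0 <= z.1, 0 <= z.2 & z.1 + z.2 <= 1]].
Definition unit_tetra : set (R * R * R) :=
  [set z | [/\ 0 <= z.1.1, 0 <= z.1.2, 0 <= z.2 & z.1.1 + z.1.2 + z.2 <= 1]].

(* The affine map s |-> v0 + s *m E sends a reference cell of R^d onto a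
   d-dimensional face of R^4, and multiplies d-dimensional volumes by the
   square root of the Gram determinant of the rows of E. *)
Definition vol (d : nat) (E : 'M[R]_(d, 4)) : R := Num.sqrt (\det (E *m E^T)).

Definition edges (d : nat) (v0 : 'rV[R]_4) (v : seq 'rV[R]_4) : 'M[R]_(d, 4) :=
  \matrix_(i < d) (v`_i - v0).

Definition int_segment (v0 v1 : 'rV[R]_4) (f : 'rV[R]_4 -> R) : R :=
  let E := edges 1 v0 [:: v1] in
  vol E * \int[leb1]_(z in unit_segment) f (v0 + pt 1 [:: z] *m E).

Definition int_triangle (v0 v1 v2 : 'rV[R]_4) (f : 'rV[R]_4 -> R) : R :=
  let E := edges 2 v0 [:: v1; v2] in
  vol E * \int[leb2]_(z in unit_triangle) f (v0 + pt 2 [:: z.1; z.2] *m E).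

Definition int_parallelogram (v0 v1 v2 : 'rV[R]_4) (f : 'rV[R]_4 -> R) : R :=
  let E := edges 2 v0 [:: v1; v2] in
  vol E * \int[leb2]_(z in unit_segment `*` unit_segment)
            f (v0 + pt 2 [:: z.1; z.2] *m E).

Definition int_tetra (v0 v1 v2 v3 : 'rV[R]_4) (f : 'rV[R]_4 -> R) : R :=
  let E := edges 3 v0 [:: v1; v2; v3] in
  vol E * \int[leb3]_(z in unit_tetra)
            f (v0 + pt 3 [:: z.1.1; z.1.2; z.2] *m E).

(* The prism with basis v0 v1 v2 and lateral edge v0 v3. *)
Definition int_prism (v0 v1 v2 v3 : 'rV[R]_4) (f : 'rV[R]_4 -> R) : R :=
  let E := edges 3 v0 [:: v1; v2; v3] in
  vol E * \int[leb3]_(z in unit_triangle `*` unit_segment)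
            f (v0 + pt 3 [:: z.1.1; z.1.2; z.2] *m E).

Definition int_N4 (f : 'rV[R]_4 -> R) : R :=
  let c (z : R * R * R * R) := pt 4 [:: z.1.1.1; z.1.1.2; z.1.2; z.2] in
  \int[leb4]_(z in c @^-1` N4) f (c z).

(* [Sigma0 k l] : the functional l is one of the degrees of freedom. *)
Inductive Sigma0 (k : nat) : (('rV[R]_4 -> R) -> R) -> Prop :=
| dof_vertex (i : 'I_4) (b : bool) :
    Sigma0 k (fun u => u (vtx i b))
| dof_edge_T3 (i j : 'I_4) (b : bool) (q : mpoly 4 R) :
    (i < j)%N -> PolyP (k%:Z - 2) q ->
    Sigma0 k (fun u =>
      int_segment (vtx i b) (vtx j b) (fun x => u x * ev q x))
| dof_edge_T1 (i : 'I_4) (q : mpoly 4 R) :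
    PolyP (k%:Z - 2) q ->
    Sigma0 k (fun u =>
      int_segment (vtx i false) (vtx i true) (fun x => u x * ev q x))
| dof_triangle (i j l : 'I_4) (b : bool) (q : mpoly 4 R) :
    (i < j < l)%N -> PolyP (k%:Z - 3) q ->
    Sigma0 k (fun u =>
      int_triangle (vtx i b) (vtx j b) (vtx l b) (fun x => u x * ev q x))
| dof_quadrilateral (i j : 'I_4) (q : mpoly 4 R) :
    (i < j)%N -> PolyQ (k%:Z - 2) (k%:Z - 2) q ->
    Sigma0 k (fun u =>
      int_parallelogram (vtx i false) (vtx j false) (vtx i true)
        (fun x => u x * ev q x))
| dof_tetra (b : bool) (q : mpoly 4 R) :
    PolyP (k%:Z - 4) q ->
    Sigma0 k (fun u =>
      int_tetra (vtx (inord 0) b) (vtx (inord 1) b) (vtx (inord 2) b)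
        (vtx (inord 3) b) (fun x => u x * ev q x))
| dof_prism (i j l : 'I_4) (q : mpoly 4 R) :
    (i < j < l)%N -> PolyProd (k%:Z - 2) (k%:Z - 3) q ->
    Sigma0 k (fun u =>
      int_prism (vtx i false) (vtx j false) (vtx l false) (vtx i true)
        (fun x => u x * ev q x))
| dof_interior (q : mpoly 4 R) :
    PolyProd (k%:Z - 2) (k%:Z - 4) q ->
    Sigma0 k (fun u =>
      int_N4 (fun x => u x * ev q x * theta_T3 x * theta_T1 x)).

End Prism.

(* Main.v *)
Require Import Defs.
From mathcomp Require Import all_boot all_order all_algebra.
From mathcomp Require Import all_classical all_reals all_analysis.
From mathcomp Require Import measurable_realfun polyrcf.
From mathcomp Require Import zify ring lra.

(** The proof works in the Bernstein form of [u]. In the six barycentric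
    coordinates [bary x] (four of the tetrahedron, two of the segment) the
    functions in [VL0 k] are the values of the polynomials [U] that are
    homogeneous of degree [k] in each of the two groups of variables
    ([bernstein_VL0]): the missing degrees are filled with powers of the sums
    of the coordinates, which are 1. A face of the prism is a set [F] of
    coordinates that meets both groups, the other coordinates being zero on it,
    so that the restriction of [u] to the face only sees the monomials of [U]
    in the variables of [F].

    By induction on the size of [F], no monomial of [U] involves variables of
    [F] only ([bernstein_form_eq0]). By the induction hypothesis such a
    monomial involves all of them. Hence on the face [u] is the product of the
    coordinates in [F], its bubble, and of a polynomial [q]
    ([bubble_quotE]), and the degrees of [q] are exactly those allowed in the
    test functions of the face ([bubble_quot_PolyProd]). When a group has one
    coordinate in [F] only, that coordinate is 1 on the face and is left out of
    the bubble and of [q].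

    Testing [u] with [q] makes the integral of the bubble times [q] squared
    vanish. The integrand is a nonnegative polynomial, so it is zero in the
    interior of the face ([chart_integral_eq0], [face_interior_eq0]), where
    the bubble is positive; thus [u] is zero there. By homogeneity [U] is then
    zero at all points with positive coordinates in [F] and zero coordinates
    elsewhere, and a polynomial that vanishes on such an orthant has no
    monomial in the variables of [F] ([orthant_no_monomial]). The factor by
    which the chart of the face scales volumes is nonzero because Gram
    determinants of independent vectors are positive ([gram_det_gt0]). *)

Set Implicit Arguments.
Unset Strict Implicit.
Unset Printing Implicit Defensive.

Import Order.TTheory GRing.Theory Num.Theory.
Import numFieldNormedType.Exports.

Local Open Scope classical_set_scope.
Local Open Scope ring_scope.

(** * Polynomials vanishing on a coordinate orthant *)

(** Scaling separates the terms by their degree: the sum is a polynomial in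
    [t] with infinitely many roots, and its coefficients are the sums over the
    terms of equal degree. *)
Lemma scaled_sum_eq0 (R : realFieldType) (I : eqType) (s : seq I) (c : I -> R)
    (e : I -> nat) :
  (forall t, 0 < t -> \sum_(m <- s) t ^+ e m * c m = 0) ->
  forall j, \sum_(m <- s | e m == j) c m = 0.
Proof.
move=> ht j.
pose p : {poly R} := \sum_(m <- s) c m *: 'X^(e m).
have hp t : p.[t] = \sum_(m <- s) t ^+ e m * c m.
  rewrite horner_sum; apply: eq_bigr => m _.
  by rewrite hornerZ hornerXn mulrC.
have p0 : p = 0.
  apply/eqP/negPn/negP => pn0.
  have := max_poly_roots pn0 (rs := [seq i.+1%:R | i <- iota 0 (size p)]).
  rewrite size_map size_iota ltnn => h.
  suff: false by [].
  apply: h.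
    apply/allP => x /mapP[i _ ->].
    by apply/rootP; rewrite hp ht // ltr0n.
  rewrite map_inj_uniq ?iota_uniq // => a b /eqP.
  by rewrite eqr_nat eqSS => /eqP.
transitivity p`_j; last by rewrite p0 coef0.
rewrite coef_sum.
rewrite [LHS]big_mkcond; apply: eq_bigr => m _.
by rewrite coefZ coefXn eq_sym; case: eqP => _; rewrite ?mulr1 ?mulr0.
Qed.

(** Rescaling one coordinate of [v] at a time isolates the terms with a given
    exponent of that coordinate; after all the coordinates have been used, a
    single monomial is left, and it is evaluated at (1, ..., 1). *)
Lemma monomial_sum_eq0 (R : realFieldType) n (s : seq (multinom n))
    (c : multinom n -> R) :
  uniq s ->
  (forall v, (forall i, 0 < v i) ->
     \sum_(m <- s) c m * \prod_i v i ^+ m i = 0) ->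
  forall m, m \in s -> c m = 0.
Proof.
move=> us hs m ms.
have H (r : seq 'I_n) : forall v, (forall i, 0 < v i) ->
    \sum_(m' <- s | all (fun i => m' i == m i) r)
      c m' * \prod_i v i ^+ m' i = 0.
  elim: r => [|i r IHr] v v0 //=; first exact: hs.
  pose s' := [seq m' : multinom n <- s | all (fun i => m' i == m i) r].
  transitivity (\sum_(m' <- s' | m' i == m i) c m' * \prod_i v i ^+ m' i).
    by rewrite big_filter_cond; apply: eq_bigl => m' /=; rewrite andbC.
  apply: (scaled_sum_eq0 (e := fun m' : multinom n => m' i)).
  move=> t t0.
  rewrite /s' big_filter -[RHS](IHr (fun j => if j == i then t * v j else v j)); last first.
    by move=> j; case: ifP => // _; rewrite mulr_gt0.
  apply: eq_bigr => m' _; rewrite mulrCA; congr (_ * _).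
  rewrite (bigD1 i) //= [RHS](bigD1 i) //= eqxx exprMn -mulrA; congr (_ * (_ * _)).
  by apply: eq_bigr => j /negbTE ->.
have := H (enum 'I_n) (fun=> 1) (fun=> ltr01).
rewrite -big_filter (bigD1_seq m) /=; last 2 first.
  by rewrite mem_filter ms andbT; apply/allP.
  exact: filter_uniq.
rewrite big1 ?mulr1 => [|i _]; last by rewrite expr1n.
rewrite big1_seq ?addr0 // => m' /andP[nm].
rewrite mem_filter => /andP[/allP am _].
case/eqP: nm; apply/mnmP => i; apply/eqP/am; exact: mem_enum.
Qed.

Definition supported_in n (F : {set 'I_n}) (m : multinom n) : bool :=
  [forall i, (i \notin F) ==> (m i == 0%N)].

Lemma meval_off n (R : comNzRingType) (F : {set 'I_n}) (w : 'I_n -> R) (U : mpoly n R) :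
  (forall i, i \notin F -> w i = 0) ->
  meval w U = \sum_(m <- msupp U | supported_in F m) mcoeff m U * \prod_i w i ^+ m i.
Proof.
move=> w0; rewrite mevalE [LHS](bigID (supported_in F)) /= [X in _ + X]big1 ?addr0 //.
move=> m /forallPn[i]; rewrite negb_imply => /andP[iF mi].
by rewrite (bigD1 i) //= w0 // expr0n (negbTE mi) mul0r mulr0.
Qed.

(** Setting the variables outside [F] to 0 keeps exactly the monomials in the
    variables of [F], which are then separated by their values on the orthant. *)
Lemma orthant_no_monomial n (R : realFieldType) (F : {set 'I_n}) (U : mpoly n R) :
  (forall w, (forall i, i \in F -> 0 < w i) ->
     (forall i, i \notin F -> w i = 0) -> meval w U = 0) ->
  forall m, m \in msupp U -> ~~ supported_in F m.
Proof.
move=> hU m mU; apply/negP => mF.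
have : mcoeff m U = 0.
  apply: (@monomial_sum_eq0 _ _ [seq m <- msupp U | supported_in F m] (fun m => mcoeff m U)).
  - by rewrite filter_uniq ?msupp_uniq.
  - move=> v v0; rewrite big_filter.
    rewrite -[RHS](hU (fun i => if i \in F then v i else 0)); last 2 first.
    + by move=> i ->.
    + by move=> i /negbTE ->.
    rewrite (meval_off (F := F)); last by move=> i /negbTE ->.
    apply: eq_bigr => m' /forallP mF'; congr (_ * _); apply: eq_bigr => i _.
    case: ifPn => // iF; have /eqP -> := implyP (mF' i) iF; by rewrite !expr0.
  - by rewrite mem_filter mF.
by apply/eqP; rewrite -mcoeff_msupp.
Qed.

Lemma mpoly_eq0 n (R : realFieldType) (p : mpoly n R) :
  (forall v, meval v p = 0) -> p = 0.
Proof.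
move=> hp; apply: msuppnil0.
case E: (msupp p) => [//|m s].
have := @orthant_no_monomial n R [set: 'I_n] p (fun w _ _ => hp w) m.
rewrite E mem_head => /(_ isT) /negP[].
by apply/forallP => i; rewrite inE.
Qed.

(** * Gram determinants *)

(** The polynomial det(E E^T + t) is monic, hence positive for large [t]. It
    has no root [t >= 0], because v (E E^T + t) v^T is the sum of the squared
    norm of v E and of t times the squared norm of v. So it is positive at 0 by
    the intermediate value theorem. *)
Lemma gram_det_gt0 (R : rcfType) d n (E : 'M[R]_(d, n)) :
  (forall z : 'rV_d, z *m E = 0 -> z = 0) -> 0 < \det (E *m E^T).
Proof.
move=> hE; set A := E *m E^T.
pose p := char_poly (- A).
have pE t : p.[t] = \det (A + t%:M).
  rewrite /p /char_poly -horner_evalE -det_map_mx; congr (\det _).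
  apply/matrixP => i j; rewrite /char_poly_mx !mxE /= /horner_eval hornerD hornerMn hornerX.
  by rewrite hornerN hornerC opprK addrC.
have pn0 t : 0 <= t -> ~~ root p t.
  move=> t0; rewrite /root pE; apply/negP => /det0P[v vn0 /(congr1 (fun w => w *m v^T))].
  rewrite mul0mx mulmxDr mulmxDl mul_mx_scalar -scalemxAl mulmxA -mulmxA.
  rewrite -trmx_mul => /(congr1 (fun A1 : 'M[R]_1 => A1 0 0)).
  have nn m (w : 'rV[R]_m) : (w *m w^T) 0 0 = \sum_i w 0 i ^+ 2.
    by rewrite mxE; apply: eq_bigr => i _; rewrite mxE expr2.
  rewrite mxE [X in _ + X]mxE !nn mxE => /eqP.
  rewrite paddr_eq0 ?mulr_ge0 ?sumr_ge0 // => [|i _|i _]; try exact: sqr_ge0.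
  rewrite psumr_eq0 => [/andP[/allP h _]|i _]; last exact: sqr_ge0.
  case/eqP: vn0; apply: hE; apply/rowP => i; rewrite [RHS]mxE.
  by apply/eqP; rewrite -sqrf_eq0; apply: h; exact: mem_index_enum.
have -> : \det A = p.[0] by rewrite pE raddf0 addr0.
case: (ltgtP 0 p.[0]) => // [p0|p0]; last first.
  by have := pn0 0 (lexx _); rewrite /root -p0 eqxx.
have [x x0 px] : exists2 x, 0 <= x & 0 < p.[x].
  have lp : 0 < lead_coef p by rewrite (monicP (char_poly_monic _)).
  have [x hx] := poly_pinfty_gt_lc lp.
  exists (Num.max x 0); first by rewrite le_max lexx orbT.
  by apply: lt_le_trans lp (hx _ _); rewrite le_max lexx.
have h0 : p.[0] * p.[x] < 0 by rewrite nmulr_rlt0.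
have [y] := poly_ivtoo x0 h0.
rewrite in_itv /= => /andP[/ltW y0 _] ry; by case/negP: (pn0 _ y0).
Qed.

(** * Products of the Lebesgue measure *)

Section Cubes.
Variable R : realType.

Definition cube d T (s : T -> seq R) (c : nat -> R) (r : R) : set T :=
  [set z | forall i, (i < d)%N -> `|(s z)`_i - c i| <= r].

(** [s] lists the coordinates of a point of [T]. Cubes of positive and finite
    measure are all that is needed of Lebesgue measure: a positive function has
    a positive integral on a small cube, and a large cube bounds the integrals.
    This form is stable under products with a line, which gives the measures
    on R^2, R^3 and R^4 at once. *)
Definition euclidean d (dT : measure_display) (T : measurableType dT)
    (mu : {measure set T -> \bar R}) (s : T -> seq R) : Prop :=
  [/\ forall z, size (s z) = d,
      forall y : nat -> R, exists z, forall i, (i < d)%N -> (s z)`_i = y i,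
      forall i, measurable_fun setT (fun z => (s z)`_i)
    & forall c r, 0 < r -> measurable (cube d s c r) /\
        (0 < mu (cube d s c r) < +oo)%E].

Lemma leb1_closed_ball (a r : R) : 0 < r ->
  measurable ([set t | `|t - a| <= r] : set (measurableTypeR R)) /\
  (0 < leb1 R [set t | (`|t - a| <= r)%R] < +oo)%E.
Proof.
move=> r0.
have -> : [set t | `|t - a| <= r] = [set` `[a - r, a + r]].
  by apply/seteqP; split => t /=; rewrite in_itv /= ler_distl.
split; first exact: measurable_itv.
rewrite [leb1 R _]lebesgue_measure_itv /= lte_fin ifT; last by lra.
by rewrite -EFinD lte_fin ltry andbT; lra.
Qed.

Lemma euclidean1 : euclidean 1 (leb1 R) (fun z => [:: z]).
Proof.
split => // [y|[|i]|c r r0].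
- by exists (y 0%N) => -[].
- exact: measurable_id.
- rewrite (_ : (fun z => _) = cst 0); first exact: measurable_cst.
  by apply/funext => z /=; rewrite nth_nil.
- have -> : cube 1 (fun z : R => [:: z]) c r = [set t | `|t - c 0%N| <= r].
    by apply/seteqP; split => [z /(_ 0%N isT)|z h [|]].
  exact: leb1_closed_ball.
Qed.

Lemma euclideanS d (dT : measure_display) (T : measurableType dT)
    (mu : {measure set T -> \bar R}) (s : T -> seq R) :
  euclidean d mu s ->
  euclidean d.+1 (mu \x leb1 R)%E
    (fun z : T * measurableTypeR R => rcons (s z.1) z.2).
Proof.
move=> [ss sj ms cs]; split.
- by move=> z; rewrite size_rcons ss.
- move=> y; have [z hz] := sj y; exists (z, y d) => i; rewrite ltnS leq_eqVlt.
  rewrite nth_rcons ss; case: ltnP => [id _|_ /orP[/eqP ->|//]]; first exact: hz.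
  by rewrite eqxx.
- move=> i; under eq_fun do rewrite nth_rcons ss.
  case: ltnP => _; first exact: measurableT_comp (ms i) measurable_fst.
  by case: eqP => _; [exact: measurable_snd|exact: measurable_cst].
- move=> c r r0.
  have -> : cube d.+1 (fun z : T * R => rcons (s z.1) z.2) c r
      = cube d s c r `*` [set t | `|t - c d| <= r].
    apply/seteqP; split => [[z t]|[z t] [] /= h1 h2 i].
      rewrite /cube /= => h; split => /= [i id|].
        by have := h i (ltnW id); rewrite nth_rcons ss id.
      by have := h d (ltnSn d); rewrite nth_rcons ss ltnn eqxx.
    rewrite nth_rcons ss ltnS leq_eqVlt; case: ltnP => [id _|_ /orP[/eqP ->|//]].
      exact: h1.
    by rewrite eqxx.
  have [m1 /andP[p1 f1]] := cs c r r0.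
  have [m2 /andP[p2 f2]] := leb1_closed_ball (c d) r0.
  split; first exact: measurableX.
  have E : (mu \x leb1 R)%E (cube d s c r `*` [set t | `|t - c d| <= r])
    = (mu (cube d s c r) * leb1 R [set t | (`|t - c d| <= r)%R])%E.
    exact: product_measure1E.
  suff: (0 < mu (cube d s c r) * leb1 R [set t | (`|t - c d| <= r)%R] < +oo)%E.
    by rewrite -E.
  by rewrite mule_gt0 //= lte_mul_pinfty // ge0_fin_numE.
Qed.

Lemma euclidean2 : euclidean 2 (leb2 R) (fun z => [:: z.1; z.2]).
Proof. exact: euclideanS euclidean1. Qed.

Lemma euclidean3 : euclidean 3 (leb3 R) (fun z => [:: z.1.1; z.1.2; z.2]).
Proof. exact: euclideanS euclidean2. Qed.

Lemma euclidean4 :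
  euclidean 4 (leb4 R) (fun z => [:: z.1.1.1; z.1.1.2; z.1.2; z.2]).
Proof. exact: euclideanS euclidean3. Qed.

End Cubes.

(** The integral is at least that of the constant [e] on [A]. The upper bound
    [M] keeps it finite: the real-valued integral of a function with infinite
    integral is 0 by convention. *)
Lemma Rintegral_neq0 (R : realType) (dT : measure_display)
    (T : measurableType dT) (mu : {measure set T -> \bar R}) (D A : set T)
    (h : T -> R) (M e : R) :
  measurable D -> (mu D < +oo)%E -> measurable_fun D h ->
  (forall z, D z -> 0 <= h z <= M) ->
  measurable A -> A `<=` D -> (0 < mu A)%E -> 0 < e ->
  (forall z, A z -> e <= h z) ->
  \int[mu]_(z in D) h z <> 0.
Proof.
move=> mD fD mh hM mA AD A0 e0 eh.
have mh' : measurable_fun D (EFin \o h) by exact/measurable_EFinP.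
have le1 : (e%:E * mu A <= \int[mu]_(z in D) (h z)%:E)%E.
  rewrite -integral_cst //; apply: (@le_trans _ _ (\int[mu]_(z in A) (h z)%:E)%E).
    apply: ge0_le_integral => //=.
    - by move=> z _; rewrite lee_fin ltW.
    - exact: (measurable_funS mD AD mh').
  apply: ge0_subset_integral => //.
  by move=> z /hM /andP[]; rewrite lee_fin.
have le2 : (\int[mu]_(z in D) (h z)%:E <= M%:E * mu D)%E.
  rewrite -integral_cst //; apply: ge0_le_integral => //=.
  - by move=> z /hM /andP[]; rewrite lee_fin.
  - by move=> z /hM /andP[]; rewrite lee_fin.
have gt0 : (0 < \int[mu]_(z in D) (h z)%:E)%E.
  by apply: lt_le_trans le1; rewrite mule_gt0 ?lte_fin.
have fin : (\int[mu]_(z in D) (h z)%:E < +oo)%E.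
  apply: le_lt_trans le2 _.
  have : (mu D \is a fin_num) by rewrite ge0_fin_numE.
  by move=> /fineK <-; rewrite -EFinM ltry.
rewrite /Rintegral => /eqP; rewrite fine_eq0 ?ge0_fin_numE ?ltW // => /eqP i0.
by rewrite i0 ltxx in gt0.
Qed.

(** * Barycentric coordinates and Bernstein form *)

(** The variables of the Bernstein form are indexed by the four barycentric
    coordinates of the tetrahedron followed by the two of the segment. *)
Definition tetra_idx (a : 'I_4) : 'I_(4 + 2) := lshift 2 a.
Definition seg_idx (b : bool) : 'I_(4 + 2) := rshift 4 (if b then ord_max else ord0).
Local Notation L := tetra_idx.
Local Notation N := seg_idx.

Lemma bary_idx_ind (P : 'I_(4 + 2) -> Prop) :
  (forall a, P (L a)) -> (forall b, P (N b)) -> forall i, P i.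
Proof.
move=> hL hN i; case: (splitP i) => [a ia|c ic].
  by rewrite (_ : i = L a) //; apply/val_inj.
rewrite (_ : i = N (c == ord_max)) //; apply/val_inj; rewrite /= ic.
by case: c {ic} => [[|[|c]] hc].
Qed.

Lemma big_bary_idx (T : Type) (idx : T) (op : Monoid.com_law idx) (F : 'I_(4 + 2) -> T) :
  \big[op/idx]_i F i =
  op (\big[op/idx]_a F (L a)) (\big[op/idx]_(b : bool) F (N b)).
Proof.
rewrite big_split_ord /=; congr (op _ _).
rewrite (reindex (fun b : bool => if b then ord_max else ord0 : 'I_2)) //.
exists (fun c : 'I_2 => c == ord_max) => [[]|[[|[|c]] hc]] //= _; exact/val_inj.
Qed.

Section Bary.
Variable R : realType.
Implicit Types (x : 'rV[R]_4) (p q : mpoly 4 R).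

Definition bary x (i : 'I_(4 + 2)) : R :=
  match fintype.split i with inl a => lambda a x | inr c => nu (c == ord_max) x end.

Lemma bary_tetra x a : bary x (L a) = lambda a x.
Proof. by rewrite /bary /tetra_idx -[lshift 2 a]/(unsplit (inl a)) unsplitK. Qed.

Lemma bary_seg x b : bary x (N b) = nu b x.
Proof.
rewrite /bary /seg_idx -[rshift 4 _]/(unsplit (inr (if b then ord_max else ord0))).
by rewrite unsplitK; case: b.
Qed.

Lemma sum4 (f : 'I_4 -> R) :
  \sum_(a < 4 | (a < 3)%N) f a + f ord_max = \sum_a f a.
Proof.
rewrite [RHS](bigD1 ord_max) //= addrC; congr (_ + _).
by apply: eq_bigl => a; rewrite -val_eqE /= ltn_neqAle -ltnS ltn_ord andbT.
Qed.

Lemma sum_bary_tetra x : \sum_a bary x (L a) = 1.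
Proof.
rewrite -sum4 bary_tetra /lambda eqxx.
rewrite (eq_bigr (fun a => (2^-1 + 2^-1 * x 0 a : R))) => [|a a3].
  rewrite big_split /= -mulr_sumr sumr_const.
  have -> : #|(fun a : 'I_4 => (a < 3)%N)| = 3%N.
    rewrite -sum1_card (eq_bigl (fun a : 'I_4 => (a < 3)%N)) //.
    by rewrite big_mkcond !big_ord_recl big_ord0.
  by rewrite -mulr_natl; lra.
have a4 : (a == ord_max) = false by rewrite -val_eqE /= ltn_eqF.
by rewrite bary_tetra /lambda a4; lra.
Qed.

Lemma sum_bary_seg x : \sum_b bary x (N b) = 1.
Proof. by rewrite big_bool /= !bary_seg /nu; lra. Qed.

Lemma coord_bary x (j : 'I_4) :
  x 0 j = if j == ord_max then bary x (N true) - bary x (N false)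
          else 2 * bary x (L j) - \sum_a bary x (L a).
Proof.
case: eqP => [->|/eqP j3]; first by rewrite !bary_seg /nu; lra.
by rewrite sum_bary_tetra bary_tetra /lambda (negbTE j3); lra.
Qed.

Definition var (j : 'I_4) : mpoly 4 R := mpolyX R (mnm1 j).

Definition bary_poly (i : 'I_(4 + 2)) : mpoly 4 R :=
  match fintype.split i with
  | inl a => if a == ord_max then (- 2^-1) *: (1 + \sum_(j < 4 | (j < 3)%N) var j)
             else 2^-1 *: (1 + var a)
  | inr c => 2^-1 *: (if c == ord_max then 1 + var ord_max else 1 - var ord_max)
  end.

Lemma evD p q x : ev (p + q) x = ev p x + ev q x. Proof. exact: mevalD. Qed.
Lemma evM p q x : ev (p * q) x = ev p x * ev q x. Proof. exact: mevalM. Qed.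
Lemma evZ c p x : ev (c *: p) x = c * ev p x. Proof. exact: mevalZ. Qed.
Lemma ev1 x : ev 1 x = 1. Proof. exact: meval1. Qed.
Lemma ev_var j x : ev (var j) x = x 0 j. Proof. exact: mevalXU. Qed.
Lemma ev_sum (I : Type) (r : seq I) (P : pred I) (F : I -> mpoly 4 R) x :
  ev (\sum_(i <- r | P i) F i) x = \sum_(i <- r | P i) ev (F i) x.
Proof. exact: raddf_sum. Qed.
Lemma ev_prod (I : Type) (r : seq I) (P : pred I) (F : I -> mpoly 4 R) x :
  ev (\prod_(i <- r | P i) F i) x = \prod_(i <- r | P i) ev (F i) x.
Proof. exact: rmorph_prod. Qed.
Lemma evX p n x : ev (p ^+ n) x = ev p x ^+ n.
Proof. exact: rmorphXn. Qed.

Lemma ev_bary_poly i x : ev (bary_poly i) x = bary x i.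
Proof.
rewrite /bary_poly /bary; case: (fintype.split i) => [a|c].
  rewrite /lambda; case: ifP => _; rewrite evZ evD ev1 ?ev_var; last by lra.
  by rewrite ev_sum (eq_bigr (fun j => x 0 j)) => [|j _]; rewrite ?ev_var //; lra.
rewrite evZ /nu; case: ifP => _.
  by rewrite evD ev1 ev_var; lra.
by rewrite -scaleN1r evD evZ ev1 ev_var; lra.
Qed.

Lemma PolyT3M (a b : int) p q : PolyT3 a p -> PolyT3 b q -> PolyT3 (a + b) (p * q).
Proof.
move=> [pa p3] [qb q3]; split => m /msuppM_le /allpairsP[[m1 m2] /= [h1 h2 ->]].
  by rewrite mdegD PoszD lerD ?pa ?qb.
by rewrite mnmDE p3 ?q3.
Qed.

Lemma PolyT1M (a b : int) p q : PolyT1 a p -> PolyT1 b q -> PolyT1 (a + b) (p * q).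
Proof.
move=> [pa p3] [qb q3]; split => m /msuppM_le /allpairsP[[m1 m2] /= [h1 h2 ->]].
  by rewrite mdegD PoszD lerD ?pa ?qb.
by move=> i i3; rewrite mnmDE p3 ?q3.
Qed.

Lemma PolyT3_1 : PolyT3 0 (1 : mpoly 4 R).
Proof. by split => m; rewrite msupp1 inE => /eqP ->; rewrite ?mdeg0 ?mnm0E. Qed.
Lemma PolyT1_1 : PolyT1 0 (1 : mpoly 4 R).
Proof. by split => m; rewrite msupp1 inE => /eqP -> *; rewrite ?mdeg0 ?mnm0E. Qed.

Lemma PolyT3_bary a : PolyT3 1 (bary_poly (L a)).
Proof.
have h m : m \in msupp (bary_poly (L a)) ->
    (mdeg m <= 1)%N /\ m ord_max = 0%N.
  rewrite /bary_poly /tetra_idx -[lshift 2 a]/(unsplit (inl a)) unsplitK.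
  have h0 m' : m' \in msupp (1 : mpoly 4 R) -> (mdeg m' <= 1)%N /\ m' ord_max = 0%N.
    by rewrite msupp1 inE => /eqP ->; rewrite mdeg0 mnm0E.
  have h1 j m' : j != ord_max -> m' \in msupp (var j) ->
      (mdeg m' <= 1)%N /\ m' ord_max = 0%N.
    by move=> /negbTE j3; rewrite msuppX inE => /eqP ->; rewrite mdeg1 mnm1E j3.
  case: ifPn => a3 /msuppZ_le /msuppD_le; rewrite mem_cat => /orP[/h0 //|].
    move=> /msupp_sum_le /flatten_mapP[j]; rewrite mem_filter => /andP[j3 _].
    by apply: h1; rewrite -val_eqE /= ltn_eqF.
  exact: h1.
by split => m /h[].
Qed.

Lemma PolyT1_bary b : PolyT1 1 (bary_poly (N b)).
Proof.
have h m : m \in msupp (bary_poly (N b)) ->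
    (mdeg m <= 1)%N /\ forall j : 'I_4, j != ord_max -> m j = 0%N.
  rewrite /bary_poly /seg_idx.
  rewrite -[rshift 4 _]/(unsplit (inr (if b then ord_max else ord0))) unsplitK.
  have h0 m' : m' \in msupp (1 : mpoly 4 R) ->
      (mdeg m' <= 1)%N /\ forall j : 'I_4, j != ord_max -> m' j = 0%N.
    by rewrite msupp1 inE => /eqP ->; rewrite mdeg0; split => // i _; rewrite mnm0E.
  have h1 m' : m' \in msupp (var ord_max) ->
      (mdeg m' <= 1)%N /\ forall j : 'I_4, j != ord_max -> m' j = 0%N.
    rewrite msuppX inE => /eqP ->; rewrite mdeg1; split => // i i3.
    by rewrite mnm1E eq_sym (negbTE i3).
  case: ifP => _ /msuppZ_le.
    by move=> /msuppD_le; rewrite mem_cat => /orP[/h0 //|/h1].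
  by move=> /msuppB_le; rewrite mem_cat => /orP[/h0 //|/h1].
by split => m /h[].
Qed.

Lemma PolyT3_prod (P : pred 'I_4) (e : 'I_4 -> nat) :
  PolyT3 (\sum_(a | P a) e a)%N%:Z (\prod_(a | P a) bary_poly (L a) ^+ e a).
Proof.
elim/big_rec2 : _ => [|a n p _ ih]; first exact: PolyT3_1.
rewrite PoszD; apply: PolyT3M ih.
elim: (e a) => [|n' ih']; first exact: PolyT3_1.
rewrite exprS -add1n PoszD; apply: PolyT3M ih'; exact: PolyT3_bary.
Qed.

Lemma PolyT1_prod (P : pred bool) (e : bool -> nat) :
  PolyT1 (\sum_(a | P a) e a)%N%:Z (\prod_(a | P a) bary_poly (N a) ^+ e a).
Proof.
elim/big_rec2 : _ => [|a n p _ ih]; first exact: PolyT1_1.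
rewrite PoszD; apply: PolyT1M ih.
elim: (e a) => [|n' ih']; first exact: PolyT1_1.
rewrite exprS -add1n PoszD; apply: PolyT1M ih'; exact: PolyT1_bary.
Qed.

Lemma PolyProd_PolyP (a b : int) p : PolyProd a b p -> PolyP (a + b) p.
Proof.
move=> [n [f [g [hf hg ->]]]] m /msupp_sum_le /flatten_mapP[i _].
move=> /msuppM_le /allpairsP[[m1 m2] /= [h1 h2 ->]].
by rewrite mdegD PoszD lerD ?(hf i).1 ?(hg i).1.
Qed.

Lemma mdeg4 (m : multinom 4) :
  (\sum_(i < 4 | (i < 3)%N) m i + m ord_max = mdeg m)%N.
Proof.
rewrite mdegE [RHS](bigD1 ord_max) //= addnC; congr (_ + _)%N.
by apply: eq_bigl => a; rewrite -val_eqE /= ltn_neqAle -ltnS ltn_ord andbT.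
Qed.

(** [PolyQ] takes the degree along the tetrahedron first, [PolyProd] takes it
    second. *)
Lemma PolyProd_PolyQ (a b : int) p : PolyProd a b p -> PolyQ b a p.
Proof.
move=> [n [f [g [hf hg ->]]]] m /msupp_sum_le /flatten_mapP[i _].
move=> /msuppM_le /allpairsP[[m1 m2] /= [h1 h2 ->]].
have E2 := mdeg4 m2; have E1 := mdeg4 m1.
rewrite ((hg i).2 m2 h2) addn0 in E2.
rewrite big1 ?add0n in E1; last first.
  by move=> j j3; rewrite (hf i).2 // -val_eqE /= ltn_eqF.
rewrite mnmDE ((hg i).2 m2 h2) addn0 E1; split; last exact: (hf i).1.
under eq_bigr do rewrite mnmDE.
rewrite big_split /= E2 big1 ?add0n; first exact: (hg i).1.
by move=> j j3; rewrite (hf i).2 // -val_eqE /= ltn_eqF.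
Qed.

Definition bihom (a b : nat) (U : mpoly (4 + 2) R) : Prop :=
  forall m, m \in msupp U -> (\sum_j m (L j) = a)%N /\ (\sum_c m (N c) = b)%N.

Definition bernstein a b (f : 'rV[R]_4 -> R) : Prop :=
  exists2 U, bihom a b U & forall x, f x = meval (bary x) U.

Lemma bernstein_ext a b f g : f =1 g -> bernstein a b f -> bernstein a b g.
Proof. by move=> fg [U hU fU]; exists U => // x; rewrite -fg. Qed.

Lemma bernsteinD a b f g : bernstein a b f -> bernstein a b g ->
  bernstein a b (fun x => f x + g x).
Proof.
move=> [U hU fU] [V hV gV]; exists (U + V) => [m /msuppD_le|x].
  by rewrite mem_cat => /orP[/hU|/hV].
by rewrite mevalD fU gV.
Qed.

Lemma bernsteinZ a b c f : bernstein a b f -> bernstein a b (fun x => c * f x).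
Proof.
move=> [U hU fU]; exists (c *: U) => [m /msuppZ_le /hU //|x].
by rewrite mevalZ fU.
Qed.

Lemma bernstein0 a b : bernstein a b (fun=> 0).
Proof. by exists 0 => [m|x]; rewrite ?meval0 // msupp0. Qed.

Lemma bernsteinM a b a' b' f g : bernstein a b f -> bernstein a' b' g ->
  bernstein (a + a') (b + b') (fun x => f x * g x).
Proof.
move=> [U hU fU] [V hV gV]; exists (U * V) => [m|x]; last by rewrite mevalM fU gV.
move=> /msuppM_le /allpairsP[[m1 m2] /= [/hU[h1 h2] /hV[h3 h4] ->]].
by split; under eq_bigr do rewrite mnmDE; rewrite big_split /= ?h1 ?h2 ?h3 ?h4.
Qed.

Lemma bernstein_sum (I : Type) (r : seq I) (P : pred I) a b (F : I -> 'rV[R]_4 -> R) :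
  (forall i, P i -> bernstein a b (F i)) ->
  bernstein a b (fun x => \sum_(i <- r | P i) F i x).
Proof.
move=> h; elim: r => [|i r ih].
  by apply: bernstein_ext (bernstein0 a b) => x; rewrite big_nil.
case Pi: (P i).
  by apply: bernstein_ext (bernsteinD (h i Pi) ih) => x; rewrite big_cons Pi.
by apply: bernstein_ext ih => x; rewrite big_cons Pi.
Qed.

Lemma bernstein_tetra j : bernstein 1 0 (fun x => bary x (L j)).
Proof.
exists (mpolyX R (mnm1 (L j))) => [m|x]; last by rewrite mevalXU.
rewrite msuppX inE => /eqP ->; split.
  rewrite (bigD1 j) //= mnm1E eqxx big1 // => k kj.
  by rewrite mnm1E (inj_eq (@lshift_inj _ _)) eq_sym (negbTE kj).
by rewrite big1 // => c _; rewrite mnm1E eq_lrshift.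
Qed.

Lemma bernstein_seg c : bernstein 0 1 (fun x => bary x (N c)).
Proof.
exists (mpolyX R (mnm1 (N c))) => [m|x]; last by rewrite mevalXU.
rewrite msuppX inE => /eqP ->; split.
  by rewrite big1 // => k _; rewrite mnm1E eq_rlshift.
rewrite (bigD1 c) //= mnm1E eqxx big1 // => k kj.
by rewrite mnm1E (inj_eq (@rshift_inj _ _)); move: kj; case: k; case: c.
Qed.

(** The constant 1 has every bidegree, being a product of powers of the sums of
    the barycentric coordinates; this allows degrees to be raised. *)
Lemma bernstein1 a b : bernstein a b (fun=> 1).
Proof.
have h0 : bernstein 0 0 (fun=> 1).
  exists 1 => [m|x]; rewrite ?meval1 // msupp1 inE => /eqP ->.
  by split; rewrite big1 // => *; rewrite mnm0E.
have h1 : bernstein 1 0 (fun=> 1).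
  apply: bernstein_ext (bernstein_sum (index_enum _) (fun a (_ : true) => bernstein_tetra a)).
  exact: sum_bary_tetra.
have h2 : bernstein 0 1 (fun=> 1).
  apply: bernstein_ext (bernstein_sum (index_enum _) (fun a (_ : true) => bernstein_seg a)).
  exact: sum_bary_seg.
have h3 : bernstein a 0 (fun=> 1).
  elim: a => // a ih; apply: bernstein_ext (bernsteinM h1 ih) => x; exact: mulr1.
elim: b => // b ih; apply: bernstein_ext (bernsteinM h2 ih) => x; exact: mulr1.
Qed.

Lemma bernstein_le a b a' b' f : (a <= a')%N -> (b <= b')%N ->
  bernstein a b f -> bernstein a' b' f.
Proof.
move=> ha hb h; rewrite -(subnKC ha) -(subnKC hb).
by apply: bernstein_ext (bernsteinM h (bernstein1 _ _)) => x; exact: mulr1.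
Qed.

Lemma bernsteinX a b f n : bernstein a b f ->
  bernstein (a * n) (b * n) (fun x => f x ^+ n).
Proof.
move=> h; elim: n => [|n ih]; first by rewrite !muln0; exact: bernstein1.
by rewrite !mulnS; apply: bernstein_ext (bernsteinM h ih) => x; rewrite exprS.
Qed.

Lemma bernstein_prod (I : Type) (r : seq I) (A B : I -> nat) (F : I -> 'rV[R]_4 -> R) :
  (forall i, bernstein (A i) (B i) (F i)) ->
  bernstein (\sum_(i <- r) A i) (\sum_(i <- r) B i) (fun x => \prod_(i <- r) F i x).
Proof.
move=> h; elim: r => [|i r ih].
  rewrite !big_nil; apply: bernstein_ext (bernstein1 0 0) => x; by rewrite big_nil.
by rewrite !big_cons; apply: bernstein_ext (bernsteinM (h i) ih) => x; rewrite big_cons.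
Qed.

Lemma bernstein_coord3 (j : 'I_4) : j != ord_max -> bernstein 1 0 (fun x => x 0 j).
Proof.
move=> j3; apply: bernstein_ext (bernsteinD (bernsteinZ 2 (bernstein_tetra j))
  (bernsteinZ (-1) (bernstein1 1 0))) => x.
by rewrite (coord_bary x j) (negbTE j3) sum_bary_tetra; ring.
Qed.

Lemma bernstein_coord4 : bernstein 0 1 (fun x => x 0 ord_max).
Proof.
apply: bernstein_ext (bernsteinD (bernstein_seg true)
  (bernsteinZ (-1) (bernstein_seg false))) => x.
by rewrite (coord_bary x ord_max) eqxx; ring.
Qed.

Lemma bernstein_PolyT3 (k : nat) p : PolyT3 k%:Z p -> bernstein k 0 (ev p).
Proof.
move=> [pk p3]; apply: (@bernstein_ext _ _ (fun x => \sum_(m <- msupp p | m \in msupp p)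
    mcoeff m p * \prod_i x 0 i ^+ m i)).
  by move=> x; rewrite /ev mevalE big_seq.
apply: bernstein_sum => m mp; apply: bernsteinZ.
apply: (@bernstein_le (\sum_i m i) (\sum_(i < 4) 0)).
- by rewrite -mdegE -lez_nat pk.
- by rewrite big1.
apply: bernstein_prod => i; have [->|i3] := eqVneq i ord_max.
  rewrite p3 //; apply: bernstein_ext (bernstein1 0 0) => x; by rewrite expr0.
by have := bernsteinX (m i) (bernstein_coord3 i3); rewrite mul1n.
Qed.

Lemma bernstein_PolyT1 (k : nat) p : PolyT1 k%:Z p -> bernstein 0 k (ev p).
Proof.
move=> [pk p3]; apply: (@bernstein_ext _ _ (fun x => \sum_(m <- msupp p | m \in msupp p)
    mcoeff m p * \prod_i x 0 i ^+ m i)).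
  by move=> x; rewrite /ev mevalE big_seq.
apply: bernstein_sum => m mp; apply: bernsteinZ.
apply: (@bernstein_le (\sum_(i < 4) 0) (\sum_i m i)).
- by rewrite big1.
- by rewrite -mdegE -lez_nat pk.
apply: bernstein_prod => i; have [->|i3] := eqVneq i ord_max.
  by have := bernsteinX (m ord_max) bernstein_coord4; rewrite mul1n.
rewrite p3 //; apply: bernstein_ext (bernstein1 0 0) => x; by rewrite expr0.
Qed.

Lemma bernstein_VL0 k u : VL0 k u -> bernstein k k (ev u).
Proof.
move=> [n [f [g [hf hg ->]]]].
apply: (@bernstein_ext _ _ (fun x => \sum_(i < n) ev (f i) x * ev (g i) x)).
  by move=> x; rewrite ev_sum; apply: eq_bigr => i _; rewrite evM.
apply: bernstein_sum => i _; rewrite -{1}[k]add0n -{2}[k]addn0.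
exact: bernsteinM (bernstein_PolyT1 (hf i)) (bernstein_PolyT3 (hg i)).
Qed.

End Bary.

(** * Integrals of nonnegative polynomials over a face *)

Section Core.
Variable R : realType.
Implicit Types (x : 'rV[R]_4) (p q : mpoly 4 R).

Lemma ev_continuous p : continuous (fun x : 'rV[R]_4 => ev p x).
Proof.
rewrite (_ : (fun x => _) = (fun x : 'rV[R]_4 =>
    \sum_(m <- msupp p) mcoeff m p * \prod_i x 0 i ^+ m i)); last first.
  by apply/funext => x; rewrite /ev mevalE.
have cprod (m : multinom 4) :
    continuous (fun x : 'rV[R]_4 => \prod_i x 0 i ^+ m i).
  apply: continuous_big; first exact: mul_continuous.
  move=> i _ y; apply: (@continuous_comp _ _ _ (fun w : 'rV[R]_4 => w 0 i)
    (fun t : R => t ^+ m i)).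
    exact: coord_continuous.
  exact: exprn_continuous.
apply: continuous_big; first exact: add_continuous.
move=> m _ x; apply: continuousM; [exact: cst_continuous|exact: cprod].
Qed.

Lemma ev_bounded p : exists M, forall x, (forall i, `|x 0 i| <= 1) -> `|ev p x| <= M.
Proof.
exists (\sum_(m <- msupp p) `|mcoeff m p|) => x x1.
rewrite /ev mevalE; apply: le_trans (ler_norm_sum _ _ _) _.
apply: ler_sum => m _; rewrite normrM ler_piMr // normr_prod.
apply: prodr_ile1 => i _; rewrite normr_ge0 /= normrX.
exact: exprn_ile1.
Qed.

Lemma bary_le1 x (i : 'I_(4 + 2)) : (forall j, 0 <= bary x j) -> bary x i <= 1.
Proof.
move=> x0; elim/bary_idx_ind: i => [a|b].
  by rewrite -(sum_bary_tetra x) (bigD1 a) //= lerDl sumr_ge0.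
by rewrite -(sum_bary_seg x) (bigD1 b) //= lerDl sumr_ge0.
Qed.

Lemma coord_bary_le1 x : (forall j, 0 <= bary x j) -> forall i, `|x 0 i| <= 1.
Proof.
move=> x0 i; rewrite coord_bary ler_norml sum_bary_tetra.
have := x0 (L i); have := x0 (N true); have := x0 (N false).
have := @bary_le1 x (L i) x0; have := @bary_le1 x (N true) x0.
have := @bary_le1 x (N false) x0.
by case: eqP => _ ? ? ? ? ? ?; apply/andP; split; lra.
Qed.

Section Chart.
Variables (d : nat) (dT : measure_display) (T : measurableType dT).
Variables (mu : {measure set T -> \bar R}) (s : T -> seq R).
Hypothesis es : euclidean d mu s.
Variables (v0 : 'rV[R]_4) (E : 'M[R]_(d, 4)).
Let X (z : T) : 'rV[R]_4 := v0 + pt d (s z) *m E.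

Let XE z j : X z 0 j = v0 0 j + \sum_(r < d) (s z)`_r * E r j.
Proof. by rewrite !mxE; congr (_ + _); apply: eq_bigr => r _; rewrite mxE. Qed.

Lemma ev_chart_measurable p : measurable_fun setT (fun z => ev p (X z)).
Proof.
have [_ _ ms _] := es.
rewrite (_ : (fun z => _) = (fun z =>
    \sum_(m <- msupp p) mcoeff m p * \prod_i (X z) 0 i ^+ m i)); last first.
  by apply/funext => z; rewrite /ev mevalE.
apply: measurable_sum => m; apply: measurable_funM; first exact: measurable_cst.
apply: measurable_prod => j _; apply: measurable_funX.
rewrite (_ : (fun z => _) = fun z => v0 0 j + \sum_(r < d) (s z)`_r * E r j).
  apply: measurable_funD; first exact: measurable_cst.
  apply: measurable_sum => r; apply: measurable_funM; first exact: ms.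
  exact: measurable_cst.
by apply/funext => z; rewrite XE.
Qed.

Lemma chart_nbhs z0 (P : set 'rV[R]_4) : nbhs (X z0) P ->
  exists2 r, 0 < r & cube d s (fun i => (s z0)`_i) r `<=` [set z | P (X z)].
Proof.
move=> /nbhs_ballP[e /= e0 eP].
pose C := 1 + \sum_(r < d) \sum_j `|E r j|.
have C0 : 0 < C by rewrite ltr_pwDl // sumr_ge0 // => *; rewrite sumr_ge0.
(* [C] bounds the variation of X by the variation of the coordinates, and the
   factor 1/2 makes the final inequality strict. *)
exists (e / C / 2); first by rewrite !divr_gt0.
move=> z hz; apply: eP; split=> // i j; rewrite ord1 /ball /= !XE.
rewrite opprD addrACA subrr add0r -sumrB.
apply: le_lt_trans (ler_norm_sum _ _ _) _.
apply: (@le_lt_trans _ _ (\sum_(r < d) e / C / 2 * \sum_j `|E r j|)).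
  apply: ler_sum => r _; rewrite -mulrBl normrM; apply: ler_pM => //; first by rewrite distrC hz.
  by rewrite (bigD1 j) //= lerDl sumr_ge0.
rewrite -mulr_sumr; apply: (@le_lt_trans _ _ (e / C / 2 * C)).
  by rewrite ler_pM2l ?divr_gt0 // lerDr.
by rewrite mulrAC divfK ?gt_eqF // ltr_pdivrMr // ltr_pMr //; lra.
Qed.

(** [X] parametrizes the affine span of the face [F] by [T], and [D] is the
    part of [T] that is mapped to the prism. *)
Variables (D : set T) (F : {set 'I_(4 + 2)}).
Hypothesis hoff : forall z i, i \notin F -> bary (X z) i = 0.
Hypothesis hD : forall z, D z <-> forall i, i \in F -> 0 <= bary (X z) i.
Hypothesis hbound : forall z, D z -> forall r : 'I_d, `|(s z)`_r| <= 1.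

Let D_bary z : D z -> forall i, 0 <= bary (X z) i.
Proof.
by move=> /hD h i; case: (boolP (i \in F)) => [/h //|/hoff ->].
Qed.

Let D_measurable : measurable D.
Proof.
rewrite (_ : D = \bigcap_(i in [set` F]) [set z | 0 <= ev (bary_poly R i) (X z)]).
  apply: fin_bigcap_measurable => [|i _]; first exact: finite_finset.
  rewrite -[X in measurable X]setTI; apply: (measurable_fun_le (f := fun=> 0)) => //.
  exact: ev_chart_measurable.
apply/seteqP; split => z /=; rewrite hD.
  by move=> h i /= /h; rewrite ev_bary_poly.
by move=> h i iF; have := h i iF; rewrite /= ev_bary_poly.
Qed.

Let D_finite : (mu D < +oo)%E.
Proof.
have [_ _ _ cs] := es; have [mc /andP[_ fc]] := cs (fun=> 0) 1 ltr01.
apply: le_lt_trans fc; apply: le_measure; rewrite ?inE //.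
by move=> z Dz i id; rewrite subr0 (hbound Dz (Ordinal id)).
Qed.

(** If [p] were positive at an interior point, it would be bounded below by a
    positive number on the image of a small cube, which stays inside the face
    because the coordinates in [F] remain positive and the others are
    identically zero on its affine span. *)
Lemma chart_integral_eq0 p :
  (forall z, D z -> 0 <= ev p (X z)) ->
  \int[mu]_(z in D) ev p (X z) = 0 ->
  forall z, (forall i, i \in F -> 0 < bary (X z) i) -> ev p (X z) = 0.
Proof.
move=> p0 ip z0 z0F.
have [_ _ _ cs] := es.
have Dz0 : D z0 by apply/hD => i /z0F /ltW.
apply/eqP/negPn/negP => pn0.
have pz0 : 0 < ev p (X z0) by rewrite lt_neqAle eq_sym pn0 p0.
have near_gt q a : a < ev q (X z0) -> \forall x \near X z0, a < ev q x.
  by move=> aq; exact: (cvgr_gt _ (@ev_continuous q (X z0)) _ aq).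
have n1 : \forall x \near X z0, ev p (X z0) / 2 < ev p x.
  by apply: near_gt; lra.
have n2 : \forall x \near X z0, forall i, i \in F -> 0 < ev (bary_poly R i) x.
  have FF : Filter (nbhs (X z0)) by exact: nbhs_filter.
  pose P i (x : 'rV[R]_4) := i \in F -> 0 < ev (bary_poly R i) x.
  apply: (@filter_forall _ _ P _ FF) => i; rewrite /P.
  case: (boolP (i \in F)) => [iF|_].
    by apply: filterS (near_gt (bary_poly R i) 0 _) => // ; rewrite ev_bary_poly z0F.
  exact: nearW.
have [r r0 hr] := chart_nbhs (filterI n1 n2).
have [mA /andP[A0 _]] := cs (fun i => (s z0)`_i) r r0.
have [M hM] := ev_bounded p.
apply: (Rintegral_neq0 (A := cube d s (fun i => (s z0)`_i) r) (M := M)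
  (e := ev p (X z0) / 2) D_measurable D_finite _ _ mA _ A0 _ _ ip).
- exact: measurable_funS (ev_chart_measurable p).
- move=> z Dz; rewrite p0 //=; apply: le_trans (ler_norm _) (hM _ _).
  exact/coord_bary_le1/D_bary.
- move=> z /hr[_ h]; apply/hD => i /h; rewrite ev_bary_poly; exact: ltW.
- by rewrite divr_gt0.
- by move=> z /hr[/ltW].
Qed.

End Chart.

End Core.

(** * The bubble factorization on a face *)

Section Face.
Variable R : realType.
Implicit Types (x : 'rV[R]_4) (p q : mpoly 4 R) (F : {set 'I_(4 + 2)}).

Definition tetra_part F : {set 'I_4} := [set a | L a \in F].
Definition seg_part F : {set bool} := [set b | N b \in F].

Lemma in_tetra_part F a : (a \in tetra_part F) = (L a \in F).
Proof. by rewrite inE. Qed.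
Lemma in_seg_part F b : (b \in seg_part F) = (N b \in F).
Proof. by rewrite inE. Qed.

(** The two groups of variables can be scaled independently; barycentric
    coordinates sum to 1 in each group, so this is what extends the vanishing
    of [U] from a face to a whole orthant. *)
Lemma meval_bihom_scale a b (U : mpoly (4 + 2) R) (s t : R) (w w' : 'I_(4 + 2) -> R) :
  bihom a b U -> (forall j, w' (L j) = s * w (L j)) ->
  (forall c, w' (N c) = t * w (N c)) ->
  meval w' U = s ^+ a * t ^+ b * meval w U.
Proof.
move=> hU wL wN; rewrite !mevalE mulr_sumr !big_seq; apply: eq_bigr => m /hU[<- <-].
rewrite mulrCA; congr (_ * _); rewrite !big_bary_idx /=.
under eq_bigr do rewrite wL exprMn.
under [X in _ * X = _]eq_bigr do rewrite wN exprMn.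
by rewrite !big_split /= !expr_sum; ring.
Qed.

(** Values prescribed to the barycentric coordinates only have to sum to 1 in
    each group. *)
Lemma bary_surj (w3 : 'I_4 -> R) (w1 : bool -> R) :
  \sum_a w3 a = 1 -> \sum_b w1 b = 1 ->
  exists2 x, forall a, bary x (L a) = w3 a & forall b, bary x (N b) = w1 b.
Proof.
move=> h3 h1; pose x : 'rV[R]_4 :=
  \row_j (if j == ord_max then w1 true - w1 false else 2 * w3 j - 1).
rewrite big_bool /= in h1.
have xL a : a != ord_max -> bary x (L a) = w3 a.
  by move=> /negbTE a3; rewrite bary_tetra /lambda a3 mxE a3; lra.
exists x => [a|b].
  have [->|/xL//] := eqVneq a ord_max.
  apply: (addrI (\sum_(a < 4 | (a < 3)%N) w3 a)).
  rewrite (sum4 w3) h3 -[RHS](sum_bary_tetra x) -sum4; congr (_ + _).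
  by apply: eq_bigr => j j3; rewrite xL // -val_eqE /= ltn_eqF.
by rewrite bary_seg /nu mxE eqxx; case: b; lra.
Qed.

Variables (k : nat) (u : mpoly 4 R) (U : mpoly (4 + 2) R).
Hypothesis hU : bihom k k U.
Hypothesis uU : forall x, ev u x = meval (bary x) U.

Section OneFace.
Variable F : {set 'I_(4 + 2)}.
Hypothesis hF3 : (0 < #|tetra_part F|)%N.
Hypothesis hF1 : (0 < #|seg_part F|)%N.
(** The form in which the induction hypothesis is used: a monomial in the
    variables of [F] that misses one of them would belong to a smaller face. *)
Hypothesis minF : forall m, m \in msupp U -> supported_in F m ->
  forall i, i \in F -> (0 < m i)%N.

Let A3 : pred 'I_4 := fun a => (1 < #|tetra_part F|)%N && (L a \in F).
Let A1 : pred bool := fun b => (1 < #|seg_part F|)%N && (N b \in F).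

(** A coordinate that is alone in its group is 1 on the face, so it is left
    out of the bubble. Keeping it in the quotient would only raise the degree
    of the latter beyond what the test functions of the face allow. *)
Definition bubble x : R :=
  (\prod_(a | A3 a) bary x (L a)) * (\prod_(b | A1 b) bary x (N b)).

Definition bubble_quot : mpoly 4 R :=
  \sum_(m <- msupp U | supported_in F m)
    (mcoeff m U *: \prod_(b | A1 b) bary_poly R (N b) ^+ (m (N b)).-1)
    * \prod_(a | A3 a) bary_poly R (L a) ^+ (m (L a)).-1.

Lemma bary_sole_tetra x : (forall i, i \notin F -> bary x i = 0) ->
  (1 < #|tetra_part F|)%N = false -> forall a, L a \in F -> bary x (L a) = 1.
Proof.
move=> hoff /negbT; rewrite -leqNgt => F31 a aF; rewrite -(sum_bary_tetra x) (bigD1 a) //=.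
rewrite big1 ?addr0 // => b ba; apply: hoff; apply: contra ba => bF.
by apply/eqP/(card_le1_eqP F31); rewrite in_tetra_part.
Qed.

Lemma bary_sole_seg x : (forall i, i \notin F -> bary x i = 0) ->
  (1 < #|seg_part F|)%N = false -> forall a, N a \in F -> bary x (N a) = 1.
Proof.
move=> hoff /negbT; rewrite -leqNgt => F31 a aF; rewrite -(sum_bary_seg x) (bigD1 a) //=.
rewrite big1 ?addr0 // => b ba; apply: hoff; apply: contra ba => bF.
by apply/eqP/(card_le1_eqP F31); rewrite in_seg_part.
Qed.

(** On the face only the monomials in the variables of [F] survive, and each of
    them contains every variable of [F]; the variables that are alone in their
    group take the value 1. *)
Lemma bubble_quotE x : (forall i, i \notin F -> bary x i = 0) ->
  ev u x = bubble x * ev bubble_quot x.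
Proof.
move=> hoff; rewrite uU (meval_off (F := F)) // ev_sum mulr_sumr big_seq_cond.
rewrite [RHS]big_seq_cond; apply: eq_bigr => m /andP[mU mF].
rewrite evM evZ !ev_prod /bubble big_bary_idx /=.
have hL : \prod_a bary x (L a) ^+ m (L a) = (\prod_(a | A3 a) bary x (L a)) *
    \prod_(a | A3 a) ev (bary_poly R (L a) ^+ (m (L a)).-1) x.
  rewrite (bigID A3) /= [X in _ * X]big1 ?mulr1.
    rewrite -big_split /=; apply: eq_bigr => a /andP[_ aF].
    by rewrite evX ev_bary_poly -exprS prednK // minF.
  move=> a; rewrite /A3 negb_and; case: (boolP (L a \in F)) => [aF|aF _].
    by rewrite orbF => /negbTE g; rewrite bary_sole_tetra // expr1n.
  by rewrite (eqP (implyP (forallP mF (L a)) aF)) expr0.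
have hN : \prod_a bary x (N a) ^+ m (N a) = (\prod_(a | A1 a) bary x (N a)) *
    \prod_(a | A1 a) ev (bary_poly R (N a) ^+ (m (N a)).-1) x.
  rewrite (bigID A1) /= [X in _ * X]big1 ?mulr1.
    rewrite -big_split /=; apply: eq_bigr => a /andP[_ aF].
    by rewrite evX ev_bary_poly -exprS prednK // minF.
  move=> a; rewrite /A1 negb_and; case: (boolP (N a \in F)) => [aF|aF _].
    by rewrite orbF => /negbTE g; rewrite bary_sole_seg // expr1n.
  by rewrite (eqP (implyP (forallP mF (N a)) aF)) expr0.
by rewrite hL hN; ring.
Qed.

Lemma PolyT3_le (a b : int) p : a <= b -> PolyT3 a p -> PolyT3 b p.
Proof. by move=> ab [pa p3]; split=> // m /pa h; exact: le_trans ab. Qed.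
Lemma PolyT1_le (a b : int) p : a <= b -> PolyT1 a p -> PolyT1 b p.
Proof. by move=> ab [pa p3]; split=> // m /pa h; exact: le_trans ab. Qed.

(** The degree of the quotient in a group that has [n] coordinates in [F]. *)
Definition quot_deg (n : nat) : int := if (1 < n)%N then k%:Z - n%:Z else 0.

Lemma sum_pred_quot_deg (I : finType) (f : I -> 'I_(4 + 2)) (S : {set I})
    (m : multinom (4 + 2)) :
  (forall i, (i \in S) = (f i \in F)) ->
  (\sum_i m (f i) = k)%N -> m \in msupp U -> supported_in F m ->
  (\sum_(i | (1 < #|S|)%N && (f i \in F)) (m (f i)).-1)%N%:Z <= quot_deg #|S|.
Proof.
move=> hS hk mU mF; rewrite /quot_deg; case: ifP => _; last by rewrite big1.
have {1}<- : (\sum_(i in S) m (f i) = k)%N.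
  rewrite -[RHS]hk [RHS](bigID (mem S)) /= [X in _ = (_ + X)%N]big1 ?addn0 //.
  by move=> i; rewrite hS => iF; exact: (eqP (implyP (forallP mF (f i)) iF)).
under eq_bigl do rewrite /= -hS.
rewrite -sum1_card lerBrDr -PoszD -big_split /= lez_nat leq_sum // => i iF.
by rewrite addn1 prednK // minF // -hS.
Qed.

(** A monomial of [U] in the variables of [F] has degree [k] in each group, and
    loses one degree for each variable of the bubble. *)
Lemma bubble_quot_PolyProd :
  PolyProd (quot_deg #|seg_part F|) (quot_deg #|tetra_part F|) bubble_quot.
Proof.
pose r := [seq m <- msupp U | supported_in F m].
have hr (i : 'I_(size r)) : tnth (in_tuple r) i \in msupp U /\ supported_in F (tnth (in_tuple r) i).
  have : tnth (in_tuple r) i \in r by exact: mem_tnth.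
  by rewrite mem_filter => /andP[].
exists (size r).
exists (fun i => let m := tnth (in_tuple r) i in
  mcoeff m U *: \prod_(b | A1 b) bary_poly R (N b) ^+ (m (N b)).-1).
exists (fun i => let m := tnth (in_tuple r) i in
  \prod_(a | A3 a) bary_poly R (L a) ^+ (m (L a)).-1); split => [i|i|].
- have [mU mF] := hr i; move: (tnth _ i) mU mF => m mU mF.
  have := PolyT1_prod R A1 (fun b => (m (N b)).-1).
  move=> /(PolyT1_le (sum_pred_quot_deg (in_seg_part F) (hU mU).2 mU mF)) [h1 h2].
  by split => m' /msuppZ_le; [exact: h1|exact: h2].
- have [mU mF] := hr i; move: (tnth _ i) mU mF => m mU mF.
  have := PolyT3_prod R A3 (fun b => (m (L b)).-1).
  exact: (PolyT3_le (sum_pred_quot_deg (in_tetra_part F) (hU mU).1 mU mF)).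
- by rewrite /bubble_quot -big_filter -/r big_tnth.
Qed.

Section FaceChart.
Variables (d : nat) (dT : measure_display) (T : measurableType dT).
Variables (mu : {measure set T -> \bar R}) (s : T -> seq R).
Hypothesis es : euclidean d mu s.
Variables (v0 : 'rV[R]_4) (E : 'M[R]_(d, 4)).
Let X (z : T) : 'rV[R]_4 := v0 + pt d (s z) *m E.
Variable (D : set T).
Hypothesis hoff : forall z i, i \notin F -> bary (X z) i = 0.
Hypothesis hD : forall z, D z <-> forall i, i \in F -> 0 <= bary (X z) i.
Hypothesis hbound : forall z, D z -> forall r : 'I_d, `|(s z)`_r| <= 1.
(** The weight is 1 on a proper face; on the prism itself the degrees of
    freedom contain the product of all the barycentric coordinates. *)
Variable weight : mpoly 4 R.
Hypothesis weight_ge0 : forall z, D z -> 0 <= ev weight (X z).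
Hypothesis weight_gt0 : forall z, (forall i, i \in F -> 0 < bary (X z) i) ->
  0 < ev weight (X z).
Hypothesis hint :
  \int[mu]_(z in D) (ev u (X z) * ev bubble_quot (X z) * ev weight (X z)) = 0.

(** The integrand is the bubble times the square of the quotient times the
    weight, and the bubble and the weight are positive in the interior. *)
Lemma face_interior_eq0 z : (forall i, i \in F -> 0 < bary (X z) i) -> ev u (X z) = 0.
Proof.
move=> zF; have pE z' : ev (u * bubble_quot * weight) (X z') =
    bubble (X z') * ev bubble_quot (X z') ^+ 2 * ev weight (X z').
  by rewrite !evM bubble_quotE //; [ring|exact: hoff].
have h0 : ev (u * bubble_quot * weight) (X z) = 0.
  apply: (chart_integral_eq0 es hoff hD hbound (p := u * bubble_quot * weight)) => //.
    move=> z' Dz'; rewrite pE; apply: mulr_ge0 (weight_ge0 Dz').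
    apply: mulr_ge0 (sqr_ge0 _).
    by apply: mulr_ge0; apply: prodr_ge0 => a /andP[_ aF]; exact: (hD z').1.
  rewrite -[RHS]hint; apply: eq_Rintegral => z' _.
  by rewrite !evM.
have : bubble (X z) != 0.
  by rewrite gt_eqF // mulr_gt0 // prodr_gt0 // => a /andP[_ /zF].
rewrite bubble_quotE; last exact: hoff.
move: h0; rewrite pE => /eqP; rewrite !mulf_eq0 (gt_eqF (weight_gt0 zF)) orbF.
by rewrite orbb => /orP[->//|/eqP ->]; rewrite mulr0.
Qed.

End FaceChart.

(** A point of the orthant becomes the list of barycentric coordinates of an
    interior point of the face once each group is divided by its sum. *)
Lemma interior_no_monomial :
  (forall x, (forall i, i \in F -> 0 < bary x i) -> (forall i, i \notin F -> bary x i = 0) ->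
    ev u x = 0) ->
  forall m, m \in msupp U -> ~~ supported_in F m.
Proof.
move=> h0; apply: orthant_no_monomial => w wp woff.
have wge i : 0 <= w i.
  by case: (boolP (i \in F)) => [/wp /ltW|/woff ->].
pose s := \sum_a w (L a); pose t := \sum_b w (N b).
have s0 : 0 < s.
  case/card_gt0P: hF3 => a; rewrite in_tetra_part => aF.
  by rewrite /s (bigD1 a) //= ltr_pwDl ?wp ?sumr_ge0.
have t0 : 0 < t.
  case/card_gt0P: hF1 => a; rewrite in_seg_part => aF.
  by rewrite /t (bigD1 a) //= ltr_pwDl ?wp ?sumr_ge0.
pose w3 a := s^-1 * w (L a); pose w1 b := t^-1 * w (N b).
have [x xL xN] : exists2 x, (forall a, bary x (L a) = w3 a) & forall b, bary x (N b) = w1 b.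
  apply: bary_surj; first by rewrite -mulr_sumr mulVf ?gt_eqF.
  by rewrite -mulr_sumr mulVf ?gt_eqF.
have : ev u x = 0.
  apply: h0 => i; elim/bary_idx_ind: i => [a|b] iF.
  - by rewrite xL mulr_gt0 ?invr_gt0 ?wp.
  - by rewrite xN mulr_gt0 ?invr_gt0 ?wp.
  - by rewrite xL /w3 woff ?mulr0.
  - by rewrite xN /w1 woff ?mulr0.
rewrite uU (meval_bihom_scale hU xL xN) => /eqP; rewrite !mulf_eq0 !expf_eq0 !invr_eq0.
by rewrite (gt_eqF s0) (gt_eqF t0) !andbF => /eqP.
Qed.

End OneFace.
End Face.

(** * Affine charts of the faces *)

Section Charts.
Variable R : realType.
Implicit Types (x : 'rV[R]_4) (p q : mpoly 4 R) (F : {set 'I_(4 + 2)}).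

Lemma bary_vtx_tetra a b a' : bary (vtx R a b) (L a') = (a' == a)%:R.
Proof.
have h c : c != ord_max -> bary (vtx R a b) (L c) = (c == a)%:R.
  by move=> /negbTE c3; rewrite bary_tetra /lambda c3 mxE c3; case: (c == a) => /=; lra.
have [->|/h//] := eqVneq a' ord_max.
apply: (addrI (\sum_(c < 4 | (c < 3)%N) (c == a)%:R)).
rewrite (sum4 (fun c => (c == a)%:R : R)).
rewrite [RHS](bigD1 a) //= eqxx [X in _ = _ + X]big1 ?addr0; last first.
  by move=> c /negbTE ->.
rewrite -[RHS](sum_bary_tetra (vtx R a b)) -sum4; congr (_ + _).
by apply: eq_bigr => c c3; rewrite h // -val_eqE /= ltn_eqF.
Qed.

Lemma bary_vtx_seg a b b' : bary (vtx R a b) (N b') = (b' == b)%:R.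
Proof. by rewrite bary_seg /nu mxE eqxx; case: b; case: b' => /=; lra. Qed.

Lemma bary_inj x y : (forall i, bary x i = bary y i) -> x = y.
Proof.
move=> h; apply/rowP => j; rewrite !coord_bary !h; case: ifP => // _.
by congr (_ - _); apply: eq_bigr.
Qed.

Lemma bary_affine (i : 'I_(4 + 2)) : exists (c : R) (g : 'I_4 -> R),
  forall x, bary x i = c + \sum_j g j * x 0 j.
Proof.
elim/bary_idx_ind: i => [a|b].
  have [->|a3] := eqVneq a ord_max.
    exists (- 2^-1), (fun j : 'I_4 => if (j < 3)%N then - 2^-1 else 0) => x.
    rewrite bary_tetra /lambda eqxx -sum4 ltnn mul0r addr0.
    rewrite [in RHS](eq_bigr (fun j => (- 2^-1 * x 0 j : R))) => [|j -> //].
    by rewrite -mulr_sumr; lra.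
  exists (2^-1), (fun j => if j == a then 2^-1 else 0) => x.
  rewrite bary_tetra /lambda (negbTE a3) (bigD1 a) //= eqxx big1 => [|j /negbTE ->].
    by lra.
  by rewrite mul0r.
exists (2^-1), (fun j => if j == ord_max then if b then 2^-1 else - 2^-1 else 0) => x.
rewrite bary_seg (bigD1 ord_max) //= big1 => [|j /negbTE ->]; last by rewrite mul0r.
by rewrite /nu; case: b; lra.
Qed.

Lemma bary_chart d v0 (v : seq 'rV[R]_4) (y : 'rV[R]_d) i :
  bary (v0 + y *m edges d v0 v) i =
  bary v0 i + \sum_(r < d) y 0 r * (bary v`_r i - bary v0 i).
Proof.
have [c [g hg]] := bary_affine i.
have hr (r : 'I_d) : y 0 r * (bary v`_r i - bary v0 i) =
    \sum_j y 0 r * (g j * v`_r 0 j - g j * v0 0 j).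
  by rewrite !hg opprD addrACA subrr add0r -sumrB mulr_sumr.
rewrite (eq_bigr _ (fun r _ => hr r)) !hg -addrA; congr (_ + _).
rewrite exchange_big -big_split /=; apply: eq_bigr => j _.
rewrite !mxE mulrDr; congr (_ + _); rewrite mulr_sumr; apply: eq_bigr => r _.
by rewrite !mxE; ring.
Qed.

Variables (a0 : 'I_4) (S : seq 'I_4) (b0 vert : bool).
Hypothesis uniqS : uniq (a0 :: S).
Hypothesis vertb : vert -> b0 = false.

(** The face has the horizontal vertices [a0 :: S], and is vertical when [vert]
    holds. Its chart has the origin [vtx a0 b0] and one edge per element of
    [dirs]: [Some a] is the edge to vertex [a] of the tetrahedron, and [None]
    the vertical edge, placed last as in the integrals over the faces. *)
Definition dirs : seq (option 'I_4) :=
  [seq Some a | a <- S] ++ (if vert then [:: None] else [::]).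
Definition dir_vertex (o : option 'I_4) : 'rV[R]_4 :=
  if o is Some a then vtx R a b0 else vtx R a0 true.
Definition dir_idx (o : option 'I_4) : 'I_(4 + 2) :=
  if o is Some a then L a else N true.
Local Notation v0 := (vtx R a0 b0).
Local Notation d := (size dirs).
Definition face_edges : 'M[R]_(d, 4) := edges d v0 (map dir_vertex dirs).

Variable F : {set 'I_(4 + 2)}.
Hypothesis FL : forall a, (L a \in F) = (a \in a0 :: S).
Hypothesis FN : forall b, (N b \in F) = vert || (b == b0).

Lemma mem_dirs_Some a : (Some a \in dirs) = (a \in S).
Proof.
rewrite mem_cat mem_map; last by move=> ? ? [].
by case: vert; rewrite ?inE ?orbF.
Qed.

Lemma mem_dirs_None : (None \in dirs) = vert.
Proof.
rewrite mem_cat [X in X || _](_ : _ = false); first by case: vert.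
by apply/negP => /mapP[].
Qed.

Lemma uniq_dirs : uniq dirs.
Proof.
rewrite cat_uniq map_inj_uniq; last by move=> ? ? [].
have uS : uniq S by case/andP: uniqS.
rewrite uS; case: vert => //=; rewrite orbF andbT.
by apply/negP => /mapP[].
Qed.

Lemma bary_dir o o' : o \in dirs -> o' \in dirs ->
  bary (dir_vertex o) (dir_idx o') = (o' == o)%:R.
Proof.
case: o o' => [a|] [a'|]; rewrite ?mem_dirs_Some ?mem_dirs_None /= => h h'.
- by rewrite bary_vtx_tetra.
- by rewrite bary_vtx_seg vertb.
- rewrite bary_vtx_tetra; case: eqP h' => // -> aS.
  by case/andP: uniqS; rewrite aS.
- by rewrite bary_vtx_seg.
Qed.

Lemma bary_dir0 o : o \in dirs -> bary v0 (dir_idx o) = 0.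
Proof.
case: o => [a|]; rewrite ?mem_dirs_Some ?mem_dirs_None /= => h.
  rewrite bary_vtx_tetra; case: eqP h => // -> aS.
  by case/andP: uniqS; rewrite aS.
by rewrite bary_vtx_seg vertb.
Qed.

Lemma nth_dir_vertex (r : 'I_d) : (map dir_vertex dirs)`_r = dir_vertex (nth None dirs r).
Proof. by rewrite (nth_map None). Qed.

(** The coordinates of the chart are themselves barycentric coordinates; this
    makes the chart injective and describes the face by inequalities. *)
Lemma bary_face_chart (y : 'rV[R]_d) (r : 'I_d) :
  bary (v0 + y *m face_edges) (dir_idx (nth None dirs r)) = y 0 r.
Proof.
rewrite bary_chart bary_dir0 ?mem_nth // add0r (bigD1 r) //= big1 => [|t tr].
  by rewrite nth_dir_vertex bary_dir ?mem_nth // eqxx /=; ring.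
rewrite nth_dir_vertex bary_dir ?mem_nth // nth_uniq ?uniq_dirs //.
by rewrite eq_sym val_eqE (negbTE tr) /=; ring.
Qed.

Lemma bary_face_off (y : 'rV[R]_d) i : i \notin F -> bary (v0 + y *m face_edges) i = 0.
Proof.
move=> iF; rewrite bary_chart.
have h0 : bary v0 i = 0.
  move: iF; elim/bary_idx_ind: i => [a|b].
    by rewrite FL inE negb_or bary_vtx_tetra => /andP[/negbTE ->].
  by rewrite FN negb_or bary_vtx_seg => /andP[_ /negbTE ->].
rewrite h0 big1 ?addr0 // => r _; rewrite nth_dir_vertex subr0.
suff -> : bary (dir_vertex (nth None dirs r)) i = 0 by rewrite mulr0.
have : nth None dirs r \in dirs by exact: mem_nth.
move: iF {h0}; elim/bary_idx_ind: i => [a|b]; case: (nth _ _ _) => [a'|];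
  rewrite ?FL ?FN ?mem_dirs_Some ?mem_dirs_None /= ?inE ?negb_or ?bary_vtx_tetra ?bary_vtx_seg.
- by move=> /andP[_]; case: eqP => // -> /negbTE ->.
- by move=> /andP[/negbTE ->].
- by move=> /andP[_ /negbTE ->].
- by move=> /andP[/negbTE ->].
Qed.

Lemma bary_base_tetra x : (forall i, i \notin F -> bary x i = 0) ->
  bary x (L a0) = 1 - \sum_(a <- S) bary x (L a).
Proof.
move=> off; rewrite -(sum_bary_tetra x) (bigID (mem (a0 :: S))) /= [X in _ + X - _]big1.
  by rewrite -big_uniq // big_cons /= addr0 addrK.
by move=> a aS; rewrite off // FL.
Qed.

Lemma bary_base_seg x : (forall i, i \notin F -> bary x i = 0) ->
  bary x (N b0) = 1 - (if vert then bary x (N true) else 0).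
Proof.
move=> off; rewrite -(sum_bary_seg x) big_bool /=; case: (boolP vert) => [/vertb ->|nv].
  by ring.
have : bary x (N (~~ b0)) = 0.
  by rewrite off // FN negb_or nv; case: b0.
by case: b0 => /= ->; ring.
Qed.

(** The chart reaches all the points at which the coordinates outside [F]
    vanish: the coordinates attached to the edges are prescribed, and those of
    the origin follow since each group sums to 1. *)
Lemma face_chart_surj x : (forall i, i \notin F -> bary x i = 0) ->
  v0 + (\row_(r < d) bary x (dir_idx (nth None dirs r))) *m face_edges = x.
Proof.
set y := \row_ r _ => xoff; set x' := _ + _.
have x'off i : i \notin F -> bary x' i = 0 by exact: bary_face_off.
have hd o : o \in dirs -> bary x' (dir_idx o) = bary x (dir_idx o).
  move=> oP; have od : (index o dirs < d)%N by rewrite index_mem.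
  have := bary_face_chart y (Ordinal od).
  by rewrite mxE /= nth_index.
apply: bary_inj => i; case: (boolP (i \in F)) => [|iF]; last by rewrite xoff ?x'off.
have hS a : a \in S -> bary x' (L a) = bary x (L a).
  by move=> aS; apply: (hd (Some a)); rewrite mem_dirs_Some.
have hT : vert -> bary x' (N true) = bary x (N true).
  by move=> v; apply: (hd None); rewrite mem_dirs_None.
elim/bary_idx_ind: i => [a|b].
  rewrite FL inE => /orP[/eqP ->|/hS //].
  rewrite !bary_base_tetra //; congr (_ - _); rewrite !big_seq; exact: eq_bigr.
have hb0 : bary x' (N b0) = bary x (N b0).
  by rewrite !bary_base_seg //; congr (_ - _); case: ifP => // /hT.
rewrite FN => /orP[v|/eqP -> //].
by case: b; [exact: hT|rewrite -(vertb v)].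
Qed.

Lemma vol_face_gt0 : 0 < vol face_edges.
Proof.
rewrite sqrtr_gt0; apply: gram_det_gt0 => y y0; apply/rowP => r.
by rewrite -(bary_face_chart y r) y0 addr0 bary_dir0 ?mem_nth // mxE.
Qed.

Lemma card_tetra_part : #|tetra_part F| = (size S).+1.
Proof.
rewrite -[RHS]/(size (a0 :: S)) -(card_uniqP uniqS); apply: eq_card => a.
by rewrite in_tetra_part FL.
Qed.

Lemma card_seg_part : #|seg_part F| = vert.+1.
Proof.
have -> : seg_part F = (if vert then setTfor bool else [set b0])%SET.
  by apply/setP => b; rewrite in_seg_part FN; case: vert; rewrite inE.
by case: vert; rewrite ?cards1 // cardsT card_bool.
Qed.

Lemma sum_dirs (y : nat -> R) (g : option 'I_4 -> R) :
  (forall r, (r < d)%N -> g (nth None dirs r) = y r) ->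
  \sum_(a <- S) g (Some a) = \sum_(r < size S) y r.
Proof.
move=> h; rewrite (big_nth a0) big_mkord; apply: eq_bigr => r _.
rewrite -h; last by rewrite size_cat size_map ltn_addr.
by rewrite nth_cat size_map ltn_ord (nth_map a0).
Qed.

Section FaceDof.
Variables (k : nat) (u : mpoly 4 R) (U : mpoly (4 + 2) R).
Hypothesis hU : bihom k k U.
Hypothesis uU : forall x, ev u x = meval (bary x) U.
Hypothesis minF : forall m, m \in msupp U -> supported_in F m ->
  forall i, i \in F -> (0 < m i)%N.

Lemma face_quot_PolyProd :
  PolyProd (quot_deg k vert.+1) (quot_deg k (size S).+1) (bubble_quot U F).
Proof.
by rewrite -card_tetra_part -card_seg_part; exact: bubble_quot_PolyProd.
Qed.

Variables (dT : measure_display) (T : measurableType dT).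
Variables (mu : {measure set T -> \bar R}) (s : T -> seq R) (D : set T).
Hypothesis es : euclidean d mu s.
Hypothesis hD : forall z, D z <-> [/\ forall r, (r < d)%N -> 0 <= (s z)`_r,
  \sum_(r < size S) (s z)`_r <= 1 & vert -> (s z)`_(size S) <= 1].

(** The test function is the quotient of [u] by the bubble. The volume factor is
    positive and can be dropped, and since the chart covers the affine span of
    the face, [u] vanishes at all the points that [interior_no_monomial] asks
    for. *)
Lemma face_no_monomial :
  vol face_edges * \int[mu]_(z in D) (ev u (v0 + pt d (s z) *m face_edges) *
    ev (bubble_quot U F) (v0 + pt d (s z) *m face_edges)) = 0 ->
  forall m, m \in msupp U -> ~~ supported_in F m.
Proof.
move=> /eqP; rewrite mulf_eq0 (gt_eqF vol_face_gt0) /= => /eqP hint.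
have h3 : (0 < #|tetra_part F|)%N by rewrite card_tetra_part.
have h1 : (0 < #|seg_part F|)%N by rewrite card_seg_part.
pose X z := v0 + pt d (s z) *m face_edges.
have hoff z i : i \notin F -> bary (X z) i = 0 by exact: bary_face_off.
have hs z r : (r < d)%N -> bary (X z) (dir_idx (nth None dirs r)) = (s z)`_r.
  by move=> rd; have := bary_face_chart (pt d (s z)) (Ordinal rd); rewrite mxE.
have hS z : \sum_(a <- S) bary (X z) (L a) = \sum_(r < size S) (s z)`_r.
  exact: (sum_dirs (g := fun o => bary (X z) (dir_idx o)) (hs z)).
have hv z : vert -> bary (X z) (N true) = (s z)`_(size S).
  move=> v; have := hs z (size S).
  by rewrite /dirs v nth_cat size_cat size_map ltnn subnn addn1 => ->.
have dirF o : o \in dirs -> dir_idx o \in F.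
  case: o => [a|]; rewrite ?mem_dirs_Some ?mem_dirs_None /= ?FL ?FN => h.
    by rewrite inE h orbT.
  by rewrite h.
have hD' z : D z <-> forall i, i \in F -> 0 <= bary (X z) i.
  rewrite hD; split => [[p0 p1 pv] i|h].
    have pd o : o \in dirs -> 0 <= bary (X z) (dir_idx o).
      move=> oP; rewrite -(nth_index None oP) hs ?index_mem // p0 //.
      by rewrite index_mem.
    elim/bary_idx_ind: i => [a|b].
      rewrite FL inE => /orP[/eqP ->|aS].
        by rewrite bary_base_tetra ?hS ?subr_ge0 //; exact: hoff.
      by apply: (pd (Some a)); rewrite mem_dirs_Some.
    have pb0 : 0 <= bary (X z) (N b0).
      rewrite bary_base_seg; last exact: hoff.
      by case: ifP => v; rewrite ?subr0 // hv // subr_ge0 pv.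
    rewrite FN => /orP[v|/eqP -> //]; case: b; last by rewrite -(vertb v).
    by apply: (pd None); rewrite mem_dirs_None.
  split => [r rd||v].
  - by rewrite -hs // h // dirF // mem_nth.
  - rewrite -hS -subr_ge0 -bary_base_tetra; last exact: hoff.
    by rewrite h // FL mem_head.
  - rewrite -hv // -subr_ge0; have := bary_base_seg (hoff z); rewrite v => <-.
    by rewrite h // FN v.
have hbound z : D z -> forall r : 'I_d, `|(s z)`_r| <= 1.
  move=> Dz r; have /hD[p0 _ _] := Dz.
  rewrite ger0_norm ?p0 // -hs //; apply: bary_le1 => i.
  by case: (boolP (i \in F)) => [|/hoff ->//]; exact: (hD' z).1.
apply: (interior_no_monomial hU uU h3 h1) => x xF xoff.
have [_ sj _ _] := es.
have [z hz] := sj (fun r => bary x (dir_idx (nth None dirs r))).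
have zx : X z = x.
  rewrite -[RHS](face_chart_surj xoff); congr (_ + _ *m _).
  by apply/rowP => r; rewrite !mxE hz.
rewrite -zx.
apply: (face_interior_eq0 uU minF es hoff hD' hbound (weight := 1)).
- by move=> z' _; rewrite ev1.
- by move=> z' _; rewrite ev1.
- by rewrite -[RHS]hint; apply: eq_Rintegral => z' _; rewrite ev1 mulr1.
- by move=> i iF; rewrite -/(X z) zx xF.
Qed.

End FaceDof.
End Charts.

(** * Induction over the faces *)

Section Main.
Variable R : realType.
Variables (k : nat) (u : mpoly 4 R) (U : mpoly (4 + 2) R).
Hypothesis hdof : forall l : ('rV[R]_4 -> R) -> R, Sigma0 k l -> l (ev u) = 0.
Hypothesis hU : bihom k k U.
Hypothesis uU : forall x, ev u x = meval (bary x) U.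

Lemma sorted_enum_ord n (A : {set 'I_n}) :
  sorted (fun a b : 'I_n => (a < b)%N) (enum A).
Proof.
apply: sorted_filter; first by move=> a b c; exact: ltn_trans.
rewrite -enumT -[sorted _ _]/(sorted (relpre (@nat_of_ord n) ltn) _) -sorted_map val_enum_ord.
exact: iota_ltn_sorted.
Qed.

Lemma unit_segmentE (z : R) : @unit_segment R z <-> 0 <= z <= 1.
Proof. by rewrite /unit_segment /= in_itv. Qed.

Lemma N4_baryP (x : 'rV[R]_4) : N4 x <-> forall i, 0 <= bary x i.
Proof.
split => [[h3 hs h1]|h].
  elim/bary_idx_ind => [a|b].
    rewrite bary_tetra /lambda; have [_|a3] := eqVneq; first by lra.
    have := h3 a; rewrite ltn_neqAle -ltnS ltn_ord andbT.
    by move=> /(_ a3) => /andP[]; lra.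
  by rewrite bary_seg /nu; case: b; lra.
have hx := coord_bary_le1 h; split.
- by move=> i _; rewrite -ler_norml.
- by have := h (L ord_max); rewrite bary_tetra /lambda eqxx; lra.
- by rewrite -ler_norml.
Qed.

Section OneFace.
Variable F : {set 'I_(4 + 2)}.
Hypothesis minF : forall m, m \in msupp U -> supported_in F m ->
  forall i, i \in F -> (0 < m i)%N.

(** The faces in which the segment is reduced to a vertex: vertices, horizontal
    edges, triangles and tetrahedra. *)
Lemma horizontal_face_no_monomial (a0 : 'I_4) (S : seq 'I_4) (b : bool) :
  sorted (fun a b : 'I_4 => (a < b)%N) (a0 :: S) -> uniq (a0 :: S) ->
  (forall a, (L a \in F) = (a \in a0 :: S)) ->
  (forall c, (N c \in F) = (c == b)) ->
  forall m, m \in msupp U -> ~~ supported_in F m.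
Proof.
move=> sS uS FL FN.
have nv : false -> b = false by [].
have FN' c : (N c \in F) = false || (c == b) by [].
have q0 := face_quot_PolyProd uS FL FN' hU minF.
have q : PolyP (quot_deg k (size S).+1) (bubble_quot U F).
  by have := PolyProd_PolyP q0; rewrite /quot_deg /= add0r.
case: S sS uS FL q {q0} => [|j [|l [|p [|p' S]]]].
- move=> _ uS FL _.
  have h3 : (0 < #|tetra_part F|)%N by rewrite (card_tetra_part uS FL).
  have h1 : (0 < #|seg_part F|)%N by rewrite (card_seg_part FN').
  apply: (interior_no_monomial hU uU h3 h1) => x _ xoff.
  have <- : vtx R a0 b = x.
    rewrite -[RHS](face_chart_surj uS nv FL FN' xoff).
    rewrite (_ : _ *m _ = 0) ?addr0 //.
    by apply/rowP => r; rewrite !mxE big_ord0.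
  exact: hdof (dof_vertex _ _ _ _).
- move=> /= /andP[ij _] uS FL q.
  apply: (face_no_monomial uS nv FL FN' hU uU minF
    (mu := leb1 R) (euclidean1 R) (D := @unit_segment R)).
    move=> z; rewrite unit_segmentE; split => [/andP[z0 z1]|[h1 h2 _]].
      by split=> //; [case|rewrite big_ord_recl big_ord0 addr0].
    by rewrite (h1 0%N) //= (le_trans _ h2) // big_ord_recl big_ord0 addr0.
  exact: hdof (dof_edge_T3 _ ij q).
- move=> /= /and3P[ij jl _] uS FL q.
  apply: (face_no_monomial uS nv FL FN' hU uU minF
    (mu := leb2 R) (euclidean2 R) (D := @unit_triangle R)).
    move=> z; split => [[z0 z1 z2]|[h1 h2 _]].
      by split=> //; [case=> [|[]]|rewrite !big_ord_recl big_ord0 addr0].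
    split; [exact: (h1 0%N)|exact: (h1 1%N)|].
    by move: h2; rewrite !big_ord_recl big_ord0 addr0.
  by apply: hdof (dof_triangle _ _ q); rewrite ij.
- move=> /= /and4P[ij jl lp _] uS FL q.
  apply: (face_no_monomial uS nv FL FN' hU uU minF
    (mu := leb3 R) (euclidean3 R) (D := @unit_tetra R)).
    move=> z; split => [[z0 z1 z2 z3]|[h1 h2 _]].
      by split=> //; [case=> [|[|[]]]|rewrite !big_ord_recl big_ord0 addr0 addrA].
    split; [exact: (h1 0%N)|exact: (h1 1%N)|exact: (h1 2%N)|].
    by move: h2; rewrite !big_ord_recl big_ord0 addr0 addrA.
  have p4 := ltn_ord p.
  (* Four increasing elements of 'I_4 are 0, 1, 2 and 3. *)
  have -> : a0 = inord 0 by apply/val_inj; rewrite /= inordK //; lia.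
  have -> : j = inord 1 by apply/val_inj; rewrite /= inordK //; lia.
  have -> : l = inord 2 by apply/val_inj; rewrite /= inordK //; lia.
  have -> : p = inord 3 by apply/val_inj; rewrite /= inordK //; lia.
  exact: hdof (dof_tetra _ q).
- move=> /= /and5P[ij jl lp pp _].
  by have := ltn_ord p'; lia.
Qed.

(** On the whole prism the test functions are already weighted by the product
    of the barycentric coordinates, and the chart is the identity of R^4. *)
Lemma prism_no_monomial : (forall i, i \in F) -> forall m, m \in msupp U -> ~~ supported_in F m.
Proof.
move=> FT.
have c3 : #|tetra_part F| = 4%N.
  by rewrite -[RHS](card_ord 4); apply: eq_card => a; rewrite in_tetra_part FT.
have c1 : #|seg_part F| = 2%N.
  by rewrite -[RHS]card_bool; apply: eq_card => a; rewrite in_seg_part FT.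
have q : PolyProd (quot_deg k 2) (quot_deg k 4) (bubble_quot U F).
  by have := bubble_quot_PolyProd hU minF; rewrite c3 c1.
have h3 : (0 < #|tetra_part F|)%N by rewrite c3.
have h1 : (0 < #|seg_part F|)%N by rewrite c1.
pose s (z : R * R * R * R) := [:: z.1.1.1; z.1.1.2; z.1.2; z.2].
pose X z := 0 + pt 4 (s z) *m 1%:M : 'rV[R]_4.
have XE z : X z = pt 4 (s z) by rewrite /X add0r mulmx1.
pose D : set (R * R * R * R) := [set z | N4 (pt 4 (s z))].
have hoff z i : i \notin F -> bary (X z) i = 0 by rewrite FT.
have hD z : D z <-> forall i, i \in F -> 0 <= bary (X z) i.
  by rewrite /D /= N4_baryP XE; split => h i; rewrite ?h ?FT // h ?FT.
have hb z : D z -> forall r : 'I_4, `|(s z)`_r| <= 1.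
  by move=> /N4_baryP Dz r; have := coord_bary_le1 Dz r; rewrite mxE.
pose weight := (\prod_a bary_poly R (L a)) * (bary_poly R (N false) * bary_poly R (N true)).
have wE x : ev weight x = (\prod_a bary x (L a)) * (bary x (N false) * bary x (N true)).
  by rewrite !evM !ev_bary_poly ev_prod; under eq_bigr do rewrite ev_bary_poly.
apply: (interior_no_monomial hU uU h3 h1) => x xF xoff.
have zx : X (x 0 (inord 0), x 0 (inord 1), x 0 (inord 2), x 0 (inord 3)) = x.
  rewrite XE; apply/rowP => -[[|[|[|[|//]]]] hj]; rewrite mxE /=;
    by congr (x 0 _); apply/val_inj; rewrite /= inordK.
rewrite -zx.
apply: (face_interior_eq0 uU minF (euclidean4 R) hoff hD hb (weight := weight)).
- move=> z /hD Dz; rewrite wE mulr_ge0 ?mulr_ge0 ?Dz ?FT //.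
  by apply: prodr_ge0 => a _; rewrite Dz ?FT.
- move=> z Dz; rewrite wE mulr_gt0 ?mulr_gt0 ?Dz ?FT //.
  by apply: prodr_gt0 => a _; rewrite Dz ?FT.
- rewrite -[RHS](hdof (dof_interior q)); apply: eq_Rintegral => z _.
  rewrite -/(X z) XE wE -!mulrA !bary_seg; do 3!congr (_ * _).
  by apply: eq_bigr => a _; rewrite bary_tetra.
- by move=> i iF; rewrite -/(X _) zx xF.
Qed.

(** The products with the segment: vertical edges, quadrilaterals, triangular
    prisms, and the prism itself. *)
Lemma vertical_face_no_monomial (a0 : 'I_4) (S : seq 'I_4) :
  sorted (fun a b : 'I_4 => (a < b)%N) (a0 :: S) -> uniq (a0 :: S) ->
  (forall a, (L a \in F) = (a \in a0 :: S)) ->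
  (forall c, N c \in F) ->
  forall m, m \in msupp U -> ~~ supported_in F m.
Proof.
move=> sS uS FL FN.
have nv : true -> false = false by [].
have FN' c : (N c \in F) = true || (c == false) by rewrite FN.
have := face_quot_PolyProd uS FL FN' hU minF.
case: S sS uS FL => [|j [|l [|p [|p' S]]]].
- move=> _ uS FL q.
  apply: (face_no_monomial uS nv FL FN' hU uU minF
    (mu := leb1 R) (euclidean1 R) (D := @unit_segment R)).
    move=> z; rewrite unit_segmentE; split => [/andP[z0 z1]|[h1 h2 h3]].
      by split=> //; [case|rewrite big_ord0].
    by rewrite (h1 0%N) //= h3.
  have q' := PolyProd_PolyP q; rewrite /quot_deg /= addr0 in q'.
  exact: hdof (dof_edge_T1 _ q').
- move=> /= /andP[ij _] uS FL q.
  apply: (face_no_monomial uS nv FL FN' hU uU minF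
    (mu := leb2 R) (euclidean2 R) (D := @unit_segment R `*` @unit_segment R)).
    move=> [z t]; rewrite /setX /= !unit_segmentE.
    split => [[/andP[z0 z1] /andP[t0 t1]]|[h1 h2 h3]].
      by split=> //; [case=> [|[]]|rewrite !big_ord_recl big_ord0 addr0].
    rewrite (h1 0%N) // (h1 1%N) //= h3 //.
    by split => //; move: h2; rewrite !big_ord_recl big_ord0 addr0.
  exact: hdof (dof_quadrilateral ij (PolyProd_PolyQ q)).
- move=> /= /and3P[ij jl _] uS FL q.
  apply: (face_no_monomial uS nv FL FN' hU uU minF
    (mu := leb3 R) (euclidean3 R) (D := @unit_triangle R `*` @unit_segment R)).
    move=> [z t]; rewrite /setX /= unit_segmentE.
    split => [[[z0 z1 z2] /andP[t0 t1]]|[h1 h2 h3]].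
      by split=> //; [case=> [|[|[]]]|rewrite !big_ord_recl big_ord0 addr0].
    rewrite (h1 2%N) //= h3 //; split => //; split; [exact: (h1 0%N)|exact: (h1 1%N)|].
    by move: h2; rewrite !big_ord_recl big_ord0 addr0.
  by apply: hdof (dof_prism _ q); rewrite ij.
- move=> _ uS FL _; apply: prism_no_monomial => i.
  elim/bary_idx_ind: i => [a|//]; rewrite FL; apply/negPn/negP => aS.
  have /card_uniqP card5 : uniq [:: a, a0, j, l, p & [::]] by rewrite cons_uniq aS.
  by have := max_card (mem [:: a; a0; j; l; p]); rewrite card5 card_ord.
- move=> /= /and5P[ij jl lp pp _].
  by have := ltn_ord p'; lia.
Qed.

End OneFace.

(** Since [k > 0], a monomial of [U] involves both groups of variables, so that
    a set [F] that supports one is a face of the prism. *)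
Lemma bernstein_form_eq0 (k0 : (0 < k)%N) : U = 0.
Proof.
apply: msuppnil0; case E: (msupp U) => [//|m0 r].
suff H n : forall F : {set 'I_(4 + 2)}, (#|F| <= n)%N ->
    forall m, m \in msupp U -> ~~ supported_in F m.
  have m0U : m0 \in msupp U by rewrite E mem_head.
  have /negP[] := H _ (setTfor 'I_(4 + 2)) (leqnn _) m0 m0U.
  by apply/forallP => i; rewrite inE.
elim: n => [|n IH] F Fn m mU; apply/negP => mF.
  move: Fn; rewrite leqn0 cards_eq0 => /eqP F0.
  have [h _] := hU mU; move: k0; rewrite -h big1 // => a _.
  by apply/eqP; apply: (implyP (forallP mF (L a))); rewrite F0 inE.
have minF m' : m' \in msupp U -> supported_in F m' -> forall i, i \in F -> (0 < m' i)%N.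
  move=> m'U m'F i iF; rewrite lt0n; apply/negP => /eqP mi0.
  have /negP[] : ~~ supported_in (F :\ i) m'.
    by apply: IH => //; rewrite -ltnS (leq_trans _ Fn) // [in X in (_ < X)%N](cardsD1 i) iF.
  apply/forallP => j; apply/implyP; rewrite !inE negb_and negbK.
  move=> /orP[/eqP ->|jF]; first by rewrite mi0.
  exact: (implyP (forallP m'F j)).
have ex3 : exists a, L a \in F.
  case: (pickP (fun a => L a \in F)) => [a aF|h]; first by exists a.
  have [hk _] := hU mU; move: k0; rewrite -hk big1 // => a _.
  by apply/eqP; apply: (implyP (forallP mF (L a))); rewrite (h a).
have ex1 : exists b, N b \in F.
  case: (pickP (fun b => N b \in F)) => [b bF|h]; first by exists b.
  have [_ hk] := hU mU; move: k0; rewrite -hk big1 // => a _.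
  by apply/eqP; apply: (implyP (forallP mF (N a))); rewrite (h a).
case ES: (enum (tetra_part F)) => [|a0 S].
  have [a aF] := ex3; have : a \in enum (tetra_part F) by rewrite mem_enum in_tetra_part.
  by rewrite ES.
have sS := sorted_enum_ord (tetra_part F); have uS := enum_uniq (tetra_part F).
have FL a : (L a \in F) = (a \in a0 :: S) by rewrite -ES mem_enum in_tetra_part.
rewrite ES in sS uS.
suff /negP[] : ~~ supported_in F m by [].
case: (boolP ((N true \in F) && (N false \in F))) => [/andP[Nt Nf]|nF].
  by apply: (vertical_face_no_monomial minF sS uS FL) => // -[].
have [b bF] := ex1.
apply: (horizontal_face_no_monomial minF sS uS FL (b := b)) => // c.
by apply/idP/eqP => [cF|->//]; case: b c bF cF nF => -[] // -> ->.
Qed.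

End Main.

Theorem lemma5p1 (R : realType) (k : nat) (u : mpoly 4 R)
  (hk : (1 <= k)%N)
  (hu : VL0 k u)
  (hdof : forall l : ('rV[R]_4 -> R) -> R, Sigma0 k l -> l (ev u) = 0) :
  u = 0.
Proof.
have [U hU uU] := bernstein_VL0 hu.
have U0 := bernstein_form_eq0 hdof hU uU hk.
apply: mpoly_eq0 => v.
have := uU (\row_i v i); rewrite U0 meval0 /ev => <-.
by apply: meval_eq => i; rewrite mxE.
Qed.
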